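(* For fixed $\mu\ge0$ and $\lambda>0$, write $\zeta=(\lambda,\mu)$, let $\hat\beta^{SL}_\zeta$ be the S-Lasso estimator with parameters $(\lambda,\mu)$, let $\mathcal{A}_\zeta=\{j:(\hat\beta^{SL}_\zeta)_j\neq0\}$ be its active set, and let $\hat y^{SL}_\zeta=X\hat\beta^{SL}_\zeta$. Then $$\widehat{\mathrm{df}}(\hat y^{SL}_\zeta)=\mathrm{Tr}\left[X_{.,\mathcal{A}_\zeta}\left(X_{.,\mathcal{A}_\zeta}'X_{.,\mathcal{A}_\zeta}+n\mu\,\widetilde J_{\mathcal{A}_\zeta,\mathcal{A}_\zeta}\right)^{-1}X_{.,\mathcal{A}_\zeta}'\right]$$ is an unbiased estimate of the effective degree of freedom of the S-Lasso estimate, i.e. $\mathbb{E}\big[\widehat{\mathrm{df}}(\hat y^{SL}_\zeta)\big]=\mathrm{df}(\hat y^{SL}_\zeta)$. Here $\widetilde J$ is the $p\times p$ tridiagonal matrix with diagonal $(1,2,\dots,2,1)$ and all entries immediately above and below the diagonal equal to $-1$.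
   Context: Model: $y_i=x_i\beta^*+\varepsilon_i$, $i=1,\dots,n$, where the $x_i=(x_{i,1},\dots,x_{i,p})\in\mathbb{R}^p$ are deterministic row vectors, $\beta^*\in\mathbb{R}^p$ is unknown, and $\varepsilon_1,\dots,\varepsilon_n$ are i.i.d. centered Gaussian with known variance $\sigma^2$. $X$ is the $n\times p$ matrix with rows $x_i$ and $Y=(y_1,\dots,y_n)'$. The design is standardized: $n^{-1}\sum_{i=1}^n x_{i,j}^2=1$ and $n^{-1}\sum_{i=1}^n x_{i,j}=0$ for every $j$. For $a\in\mathbb{R}^n$, $\|a\|_n^2=n^{-1}\sum_{i=1}^n|a_i|^2$; for $a\in\mathbb{R}^p$, $|a|_1=\sum_{j=1}^p|a_j|$. The S-Lasso estimator with parameters $(\lambda,\mu)$ is the minimizer over $\beta\in\mathbb{R}^p$ of $$\|Y-X\beta\|_n^2+\lambda|\beta|_1+\mu\sum_{j=2}^p(\beta_j-\beta_{j-1})^2.$$ The effective degree of freedom of a fit $\hat y=\hat y(Y)\in\mathbb{R}^n$ is $\mathrm{df}(\hat y)=\sigma^{-2}\sum_{i=1}^n\mathrm{Cov}(y_i,\hat y_i)$. $X_{.,\mathcal{B}}$ is the submatrix of $X$ formed by the columns with indices in $\mathcal{B}$; $\widetilde J_{\mathcal{B},\mathcal{B}}$ is the submatrix with row and column indices in $\mathcal{B}$; $\mathrm{Tr}$ is the trace. *)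

(* Defs.v *)
From HB Require Import structures.
From mathcomp Require Import all_boot all_order all_algebra.
From mathcomp Require Import all_classical all_reals all_analysis.
Set Implicit Arguments.
Unset Strict Implicit.
Unset Printing Implicit Defensive.
Import Order.TTheory GRing.Theory Num.Theory.
Import numFieldNormedType.Exports.

Local Open Scope classical_set_scope.
Local Open Scope ring_scope.

Section SLasso.
Variables (R : realType) (n p : nat).

Definition standardized (X : 'M[R]_(n, p)) : Prop :=
  forall j : 'I_p, n%:R^-1 * (\sum_(i < n) X i j ^+ 2) = 1
                /\ n%:R^-1 * (\sum_(i < n) X i j) = 0.

Definition sqnorm_n (a : 'cV[R]_n) : R :=
  n%:R^-1 * \sum_(i < n) `|a i 0| ^+ 2.

Definition norm1 (b : 'cV[R]_p) : R := \sum_(j < p) `|b j 0|.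

(* The sum over all pairs of consecutive indices. *)
Definition smoothness (b : 'cV[R]_p) : R :=
  \sum_(j < p) \sum_(k < p | k == j.+1 :> nat) (b k 0 - b j 0) ^+ 2.

Definition slasso_criterion (lam mu : R) (X : 'M[R]_(n, p)) (y : 'cV[R]_n)
    (b : 'cV[R]_p) : R :=
  sqnorm_n (y - X *m b) + lam * norm1 b + mu * smoothness b.

(* b is the (hence unique) minimizer of the criterion. *)
Definition is_slasso (lam mu : R) (X : 'M[R]_(n, p)) (y : 'cV[R]_n)
    (b : 'cV[R]_p) : Prop :=
  forall b' : 'cV[R]_p, b' != b ->
    slasso_criterion lam mu X y b < slasso_criterion lam mu X y b'.

Definition active_set (b : 'cV[R]_p) : {set 'I_p} := [set j | b j 0 != 0].

(* The diagonal entry counts the neighbours of i in {0, ..., p - 1}: for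
   2 <= p the diagonal is (1, 2, ..., 2, 1); for p = 1, where the smoothness
   penalty is an empty sum, the matrix is 0. *)
Definition Jtilde : 'M[R]_p :=
  \matrix_(i < p, j < p)
    if i == j then ((0 < i)%N + (i.+1 < p)%N)%:R
    else if (i.+1 == j) || (j.+1 == i) then -1 else 0.

Definition cols (B : {set 'I_p}) (X : 'M[R]_(n, p)) : 'M[R]_(n, #|B|) :=
  colsub (@enum_val _ (mem B)) X.

Definition principal (B : {set 'I_p}) (J : 'M[R]_p) : 'M[R]_#|B| :=
  mxsub (@enum_val _ (mem B)) (@enum_val _ (mem B)) J.

Definition df_hat (mu : R) (X : 'M[R]_(n, p)) (A : {set 'I_p}) : R :=
  let XA := cols A X in
  \tr (XA *m invmx (XA^T *m XA + (n%:R * mu) *: principal A Jtilde) *m XA^T).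

End SLasso.

Section Model.
Variables (R : realType) (d : measure_display) (T : measurableType d).
Variable P : probability T R.
Variable n : nat.

Definition mutually_independent (Z : 'I_n -> {RV P >-> R}) : Prop :=
  forall (I : {set 'I_n}) (B : 'I_n -> set R),
    (forall i, measurable (B i)) ->
    P (\bigcap_(i in [set` I]) (Z i @^-1` B i)) =
    (\prod_(i in I) P (Z i @^-1` B i))%E.

(* The law is compared on measurable sets only, since a measure is a function
   on all sets; sigma is the standard deviation. *)
Definition centered_gaussian (sigma : R) (Z : {RV P >-> R}) : Prop :=
  forall B : set R, measurable B -> distribution P Z B = normal_prob 0 sigma B.

Definition response p (X : 'M[R]_(n, p)) (beta : 'cV[R]_p)
    (eps : 'I_n -> {RV P >-> R}) (w : T) : 'cV[R]_n :=
  \col_(i < n) ((row i X *m beta) 0 0 + eps i w).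

Definition eff_df (sigma : R) (Y : T -> 'cV[R]_n) (yhat : 'cV[R]_n -> 'cV[R]_n)
    : \bar R :=
  ((sigma ^- 2)%:E *
     \sum_(i < n) covariance P (fun w => Y w i 0%R) (fun w => yhat (Y w) i 0%R))%E.

(* Integrability is recorded because the integral is total. *)
Definition unbiased_estimate (S : T -> R) (theta : \bar R) : Prop :=
  P.-integrable setT (EFin \o S) /\ ('E_P[S] = theta)%E.

End Model.

(* Main.v *)
Require Import Defs.
From HB Require Import structures.
From mathcomp Require Import all_boot all_order all_algebra.
From mathcomp Require Import ring lra.
From mathcomp Require Import all_classical all_reals all_analysis.
From mathcomp Require Import measurable_realfun.
Set Implicit Arguments.
Unset Strict Implicit.
Unset Printing Implicit Defensive.
Import Order.TTheory GRing.Theory Num.Theory.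
Import numFieldNormedType.Exports.

Local Open Scope classical_set_scope.
Local Open Scope ring_scope.

(** The proof is Stein's unbiased risk argument, made elementary by the fact
    that the fit is a continuous and piecewise affine function of the response.

    Write [Q] for [X^T X + n mu J], so that [n] times the criterion is, up to a
    constant, [pobj Q c u b = b' Q b - 2 u' b + 2 c |b|_1] with [u = X^T y] and
    [c = n lambda / 2]. Its minimizers are the solutions of the stationarity
    conditions [kkt] (lemmas [kkt_min] and [min_kkt]). Once the sign pattern
    [s] of the minimizer is known these conditions are affine equations and
    inequalities, which has three consequences. The minimizer is an explicit affine function of the response
    whose linear part is [V (V' Q V)^-1 V' X^T], with [V] the inclusion of the
    active coordinates ([kkt_solution]; the inverse exists because the
    minimizer is unique, [unique_min_unitmx]). The responses with pattern [s]
    form a convex set ([kkt_convex]). They also form a measurable set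
    ([measurable_pattern]). Moreover the conditions are monotone, so the
    [i]-th fitted value is a 1-Lipschitz function of the [i]-th response
    ([fit_coord_lipschitz]). Hence, when only the [i]-th response moves, the
    [i]-th fitted value is a continuous function that is affine on each of
    finitely many intervals, where its slope is the [i]-th diagonal entry
    ([leverage]) of the matrix of which [df_hat] is the trace.

    For a function [g] of this kind, [(g phi)' = (g' - t g / sigma^2) phi]
    where [phi] is the density of the centered Gaussian law. Integrating over
    the pieces gives Stein's identity [E (t g) = sigma^2 E g']
    ([stein_piecewise_affine]). The law of the noise vector does not change
    when one coordinate is replaced by an independent copy ([resample_law]),
    so Fubini's theorem carries the identity over to the whole vector
    ([stein_fit]): the covariance of the [i]-th response and the [i]-th fitted
    value is [sigma^2] times the expected [i]-th leverage. Summing over [i]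
    gives the theorem. *)

(** * Quadratic minimization with an absolute-value penalty *)

Section Dot.
Variable R : realType.

Definition dot m (a b : 'cV[R]_m) : R := \sum_(j < m) a j 0 * b j 0.

Lemma dotC m (a b : 'cV[R]_m) : dot a b = dot b a.
Proof. by apply: eq_bigr => j _; rewrite mulrC. Qed.

Lemma dotDl m (a a' b : 'cV[R]_m) : dot (a + a') b = dot a b + dot a' b.
Proof. by rewrite -big_split; apply: eq_bigr => j _; rewrite mxE mulrDl. Qed.

Lemma dotZl m k (a b : 'cV[R]_m) : dot (k *: a) b = k * dot a b.
Proof. by rewrite mulr_sumr; apply: eq_bigr => j _; rewrite mxE mulrA. Qed.

Lemma dotNl m (a b : 'cV[R]_m) : dot (- a) b = - dot a b.
Proof. by rewrite -scaleN1r dotZl mulN1r. Qed.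

Lemma dotDr m (a b b' : 'cV[R]_m) : dot a (b + b') = dot a b + dot a b'.
Proof. by rewrite dotC dotDl !(dotC a). Qed.

Lemma dotZr m k (a b : 'cV[R]_m) : dot a (k *: b) = k * dot a b.
Proof. by rewrite dotC dotZl dotC. Qed.

Lemma dotNr m (a b : 'cV[R]_m) : dot a (- b) = - dot a b.
Proof. by rewrite dotC dotNl dotC. Qed.

Lemma dot_mulmx m n (A : 'M[R]_(m, n)) a b :
  dot a (A *m b) = dot (A^T *m a) b.
Proof.
rewrite /dot; under eq_bigr do rewrite mxE mulr_sumr.
under [RHS]eq_bigr do rewrite mxE mulr_suml.
rewrite exchange_big; apply: eq_bigr => k _; apply: eq_bigr => j _.
by rewrite mxE; ring.
Qed.

Lemma dot_ge0 m (a : 'cV[R]_m) : 0 <= dot a a.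
Proof. by apply: sumr_ge0 => j _; exact: sqr_ge0. Qed.

Lemma dot_delta m (a : 'cV[R]_m) j : dot a (delta_mx j 0) = a j 0.
Proof.
rewrite /dot (bigD1 j)//= mxE !eqxx mulr1 big1 ?addr0// => k kj.
by rewrite mxE (negbTE kj) mulr0.
Qed.

End Dot.

Section PenalizedQuadratic.
Variables (R : realType) (p : nat) (Q : 'M[R]_p) (c : R).
Hypothesis Qsym : Q^T = Q.
Hypothesis c_gt0 : 0 < c.
Implicit Types u b h : 'cV[R]_p.

(** [n] times the S-Lasso criterion has this form, up to a constant. *)
Definition pobj u b : R := dot b (Q *m b) - 2 * dot u b + 2 * c * norm1 b.

(** Stationarity: [u - Q *m b] lies in [c] times the subdifferential at [b] of
    the l1 norm. The product form covers the three signs of [b j 0] at once. *)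
Definition kkt u b : Prop := forall j,
  `|(u - Q *m b) j 0| <= c /\ (u - Q *m b) j 0 * b j 0 = c * `|b j 0|.

Lemma pobj_shift u b h : pobj u (b + h) =
  pobj u b + dot h (Q *m h) - 2 * dot (u - Q *m b) h
  + 2 * c * (norm1 (b + h) - norm1 b).
Proof.
rewrite /pobj mulmxDr !(dotDl, dotDr, dotNl, dotNr).
have -> : dot h (Q *m b) = dot b (Q *m h) by rewrite dot_mulmx Qsym dotC.
have -> : dot (Q *m b) h = dot b (Q *m h) by rewrite dot_mulmx Qsym.
ring.
Qed.

(** Coordinatewise, a number of absolute value at most [c] times [b' j 0] is at
    most [c * `|b' j 0|], and [kkt] makes this an equality at [b]. *)
Lemma kkt_subgradient u b b' : kkt u b ->
  dot (u - Q *m b) (b' - b) <= c * (norm1 b' - norm1 b).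
Proof.
move=> bP; rewrite mulrBr !mulr_sumr -sumrB; apply: ler_sum => j _.
have [gc gb] := bP j; set g := (u - Q *m b) j 0 in gc gb *.
rewrite mxE [(- b) j 0]mxE mulrDr mulrN gb lerD2r.
by rewrite (le_trans (ler_norm _))// normrM ler_wpM2r.
Qed.

(** By [pobj_shift] the increment of the objective is a nonnegative quadratic
    term plus the gap in [kkt_subgradient]. *)
Lemma kkt_min u b b' : (forall h, 0 <= dot h (Q *m h)) ->
  kkt u b -> pobj u b <= pobj u b'.
Proof.
move=> Qpsd bP; rewrite -(subrKC b b') pobj_shift subrKC.
have := Qpsd (b' - b); have := kkt_subgradient b' bP; lra.
Qed.

Lemma ge0_of_small_linear (a x : R) :
  (forall t, 0 < t -> t <= 1 -> 0 <= t * a + x) -> 0 <= x.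
Proof.
move=> H; rewrite leNgt; apply/negP => x0.
have a1 : 0 < `|a| + 1 by rewrite ltr_wpDl.
have d0 : 0 < `|a| + 1 - x by rewrite subr_gt0 (lt_trans x0).
have t0 : 0 < - x / (`|a| + 1 - x) by rewrite divr_gt0 ?oppr_gt0.
have t1 : - x / (`|a| + 1 - x) <= 1 by rewrite ler_pdivrMr// mul1r lerDr ltW.
have := H _ t0 t1; set t := - x / _ in t0 t1 *.
have tE : t * (`|a| + 1 - x) = - x by rewrite /t divfK// gt_eqF.
have := ler_wpM2l (ltW t0) (ler_norm a).
have : t * x < 0 by rewrite pmulr_rlt0.
lra.
Qed.

(** Perturbing one coordinate of a minimizer [b] by [t * v] changes the
    objective by [t ^+ 2] times a constant plus a term that convexity bounds
    linearly in [t]; letting [t] tend to 0 leaves a one-dimensional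
    subgradient inequality in [v], tested at [v = - b j 0] and [v = +-1]. *)
Lemma min_kkt u b : (forall b', pobj u b <= pobj u b') -> kkt u b.
Proof.
move=> bmin j; set g := (u - Q *m b) j 0.
have norm1_delta t : norm1 (b + t *: delta_mx j 0) - norm1 b =
    `|b j 0 + t| - `|b j 0|.
  rewrite /norm1 -sumrB (bigD1 j)//= !mxE !eqxx mulr1 big1 ?addr0// => k kj.
  by rewrite !mxE (negbTE kj) mulr0 addr0 subrr.
have key v : g * v <= c * (`|b j 0 + v| - `|b j 0|).
  rewrite -subr_ge0 -(pmulr_rge0 _ (ltr0n R 2)).
  apply: (@ge0_of_small_linear (v ^+ 2 * Q j j)) => t t0 t1.
  have := bmin (b + (t * v) *: delta_mx j 0).
  rewrite pobj_shift norm1_delta dotZr dot_delta -/g -scalemxAr dotZl dotZr.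
  rewrite (dotC (delta_mx _ _)) dot_delta -colE mxE => H.
  have dj : `|b j 0 + t * v| - `|b j 0| <= t * (`|b j 0 + v| - `|b j 0|).
    have -> : b j 0 + t * v = (1 - t) * b j 0 + t * (b j 0 + v) by ring.
    rewrite (le_trans (lerB (ler_normD _ _) (lexx _)))// !normrM.
    by rewrite (ger0_norm (ltW t0)) ger0_norm ?subr_ge0//; lra.
  rewrite -(pmulr_rge0 _ t0); have := ler_wpM2l (ltW c_gt0) dj; lra.
have gc : `|g| <= c.
  rewrite ler_norml; apply/andP; split.
    have := key (-1).
    by have := ler_wpM2l (ltW c_gt0) (ler_normB (b j 0) 1); rewrite normr1; lra.
  have := key 1.
  by have := ler_wpM2l (ltW c_gt0) (ler_normD (b j 0) 1); rewrite normr1; lra.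
split=> //; apply/eqP; rewrite eq_le; apply/andP; split.
  by rewrite (le_trans (ler_norm _))// normrM ler_wpM2r.
by have := key (- b j 0); rewrite subrr normr0; lra.
Qed.

(** The optimality conditions are monotone: adding the two subgradient
    inequalities of [b1] and [b2] cancels the penalty. *)
Lemma kkt_monotone u1 u2 b1 b2 : kkt u1 b1 -> kkt u2 b2 ->
  dot (b2 - b1) (Q *m (b2 - b1)) <= dot (u2 - u1) (b2 - b1).
Proof.
move=> /(kkt_subgradient b2) + /(kkt_subgradient b1).
rewrite mulmxBr !(dotDl, dotDr, dotNl, dotNr).
have qC x y : dot (Q *m x) y = dot x (Q *m y) by rewrite dot_mulmx Qsym.
rewrite !qC (_ : dot b2 (Q *m b1) = dot b1 (Q *m b2)); first lra.
by rewrite dotC qC.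
Qed.

(** The positive and the negative support, as a pair of finite sets so that
    there are finitely many patterns. *)
Definition pattern b : {set 'I_p} * {set 'I_p} :=
  ([set j | 0 < b j 0]%SET, [set j | b j 0 < 0]%SET).

Definition pat_sign (s : {set 'I_p} * {set 'I_p}) : 'cV[R]_p :=
  \col_j ((j \in s.1)%:R - (j \in s.2)%:R).

Lemma pat_signE b j : pat_sign (pattern b) j 0 = Num.sg (b j 0).
Proof.
rewrite mxE !inE; case: (ltgtP (b j 0) 0) => [b0|b0|->].
- by rewrite ltr0_sg// sub0r.
- by rewrite gtr0_sg// subr0.
- by rewrite sgr0 subrr.
Qed.

Lemma active_pattern b : active_set b = (pattern b).1 :|: (pattern b).2.
Proof. by apply/setP => j; rewrite !inE orbC neq_lt. Qed.

Lemma pattern_eqP b s : (pattern b = s) <->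
  (forall j, ((0 < b j 0) = (j \in s.1)) /\ ((b j 0 < 0) = (j \in s.2))).
Proof.
split=> [<- j|]; first by rewrite !inE.
by case: s => P N H; congr pair; apply/setP => j; rewrite inE; have [] := H j.
Qed.

(** With the signs given, stationarity consists of affine equations and affine
    inequalities in [(u, b)]. *)
Lemma kktP u b : kkt u b <-> forall j, `|(u - Q *m b) j 0| <= c /\
  (b j 0 != 0 -> (u - Q *m b) j 0 = c * Num.sg (b j 0)).
Proof.
split=> H j; have [gc gb] := H j; split=> //.
  by move=> b0; apply: (mulIf b0); rewrite gb normrEsg mulrA.
have [->|b0] := eqVneq (b j 0) 0; first by rewrite normr0 !mulr0.
by rewrite gb// [in RHS]normrEsg mulrA.
Qed.

(** For a fixed pattern, the affine conditions of [kktP] and the sign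
    conditions are all stable under convex combinations. *)
Lemma kkt_convex u1 u2 b1 b2 t : 0 <= t -> t <= 1 ->
  kkt u1 b1 -> kkt u2 b2 -> pattern b1 = pattern b2 ->
  kkt ((1 - t) *: u1 + t *: u2) ((1 - t) *: b1 + t *: b2) /\
  pattern ((1 - t) *: b1 + t *: b2) = pattern b2.
Proof.
move=> t0 t1 /kktP k1 /kktP k2 /pattern_eqP b12.
have bE j : ((1 - t) *: b1 + t *: b2) j 0 = (1 - t) * b1 j 0 + t * b2 j 0.
  by rewrite !mxE.
have sgE j : Num.sg (((1 - t) *: b1 + t *: b2) j 0) = Num.sg (b2 j 0) /\
             Num.sg (b1 j 0) = Num.sg (b2 j 0).
  rewrite bE; have [+ +] := b12 j; rewrite !inE.
  case: (ltgtP 0 (b2 j 0)) => [b2p|b2n|<-].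
  - move=> b1p _; rewrite (gtr0_sg b1p) (gtr0_sg b2p) gtr0_sg//.
    have [->|t_neq1] := eqVneq t 1; first lra.
    have t_lt1 : t < 1 by rewrite lt_neqAle t_neq1.
    by rewrite ltr_pwDl ?mulr_gt0 ?subr_gt0// mulr_ge0// ltW.
  - move=> _ b1n; rewrite (ltr0_sg b1n) (ltr0_sg b2n) ltr0_sg//.
    have [->|t_neq1] := eqVneq t 1; first lra.
    have t_lt1 : t < 1 by rewrite lt_neqAle t_neq1.
    rewrite -oppr_gt0 opprD -!mulrN.
    by rewrite ltr_pwDl ?mulr_gt0 ?subr_gt0 ?oppr_gt0// mulr_ge0// oppr_ge0 ltW.
  - by case: (ltgtP 0 (b1 j 0)) => // <- _ _; rewrite !mulr0 addr0 !sgr0.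
have gE j : ((1 - t) *: u1 + t *: u2 - Q *m ((1 - t) *: b1 + t *: b2)) j 0 =
    (1 - t) * (u1 - Q *m b1) j 0 + t * (u2 - Q *m b2) j 0.
  by rewrite mulmxDr -!scalemxAr !mxE; ring.
split.
  apply/kktP => j; have [[g1 e1] [g2 e2]] := (k1 j, k2 j).
  rewrite gE; split.
    rewrite (le_trans (ler_normD _ _))// !normrM (ger0_norm t0).
    rewrite ger0_norm ?subr_ge0//.
    have t1' : 0 <= 1 - t by rewrite subr_ge0.
    by have := ler_wpM2l t0 g2; have := ler_wpM2l t1' g1; lra.
  rewrite -sgr_eq0 (sgE j).1 => sg0; rewrite e1 ?e2 ?(sgE j).2; first ring.
    by rewrite -sgr_eq0.
  by rewrite -sgr_eq0 (sgE j).2.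
apply/pattern_eqP => j; rewrite !inE -(sgr_gt0 (_ j 0)) -(sgr_lt0 (_ j 0)).
by rewrite (sgE j).1 sgr_gt0 sgr_lt0.
Qed.

End PenalizedQuadratic.

Section Support.
Variables (R : realType) (p : nat).
Implicit Types (A : {set 'I_p}) (b w : 'cV[R]_p).

(** The inclusion of the coordinates in [A]: its products turn the submatrices
    [cols] and [principal] into ordinary matrix algebra. *)
Definition embed A : 'M[R]_(p, #|A|) := colsub (@enum_val _ (mem A)) 1%:M.

Lemma cols_embed n A (X : 'M[R]_(n, p)) : cols A X = X *m embed A.
Proof.
apply/matrixP => i j; rewrite !mxE (bigD1 (enum_val j))//= !mxE eqxx mulr1.
by rewrite big1 ?addr0// => k /negbTE kj; rewrite !mxE kj mulr0.
Qed.

Lemma trmx_embedE m A (B : 'M[R]_(p, m)) k j :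
  ((embed A)^T *m B) k j = B (enum_val k) j.
Proof.
rewrite !mxE (bigD1 (enum_val k))//= !mxE eqxx mul1r.
by rewrite big1 ?addr0// => l /negbTE kj; rewrite !mxE kj mul0r.
Qed.

Lemma principal_embed A (J : 'M[R]_p) :
  principal A J = (embed A)^T *m J *m embed A.
Proof.
by apply/matrixP => i j; rewrite -mulmxA trmx_embedE -cols_embed !mxE.
Qed.

Lemma embedE A (v : 'cV[R]_#|A|) j : (embed A *m v) j 0 =
  \sum_(k < #|A|) (j == enum_val k)%:R * v k 0.
Proof. by rewrite mxE; apply: eq_bigr => k _; rewrite !mxE. Qed.

Lemma embed_notin A (v : 'cV[R]_#|A|) j : j \notin A -> (embed A *m v) j 0 = 0.
Proof.
move=> jA; rewrite embedE big1// => k _; case: eqP => [jE|]; last by rewrite mul0r.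
by rewrite jE enum_valP in jA.
Qed.

Lemma embedK A m (v : 'M[R]_(#|A|, m)) : (embed A)^T *m (embed A *m v) = v.
Proof.
suff -> : embed A *m v = (\matrix_(j, l) \sum_(k < #|A|) (j == enum_val k)%:R * v k l).
  apply/matrixP => k j; rewrite trmx_embedE !mxE (bigD1 k)//= eqxx mul1r.
  rewrite big1 ?addr0// => l lk; rewrite (inj_eq enum_val_inj) eq_sym.
  by rewrite (negbTE lk) mul0r.
by apply/matrixP => k j; rewrite !mxE; apply: eq_bigr => l _; rewrite !mxE.
Qed.

Lemma embed_trmxK A b : (forall j, j \notin A -> b j 0 = 0) ->
  embed A *m ((embed A)^T *m b) = b.
Proof.
move=> b0; apply/colP => j; have [jA|jA] := boolP (j \in A); last first.
  by rewrite embed_notin// b0.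
rewrite embedE (bigD1 (enum_rank_in jA j))//= enum_rankK_in// eqxx mul1r.
rewrite trmx_embedE enum_rankK_in// big1 ?addr0// => k kj.
case: eqP => [jE|]; last by rewrite mul0r.
by case/eqP: kj; apply: enum_val_inj; rewrite enum_rankK_in.
Qed.

(** With such a step one moves along [w] without leaving the orthant of [b],
    where the penalty is linear ([normrD_small]). *)
Lemma small_step b w : exists2 t : R, 0 < t &
  forall j, b j 0 != 0 -> t * `|w j 0| <= `|b j 0|.
Proof.
pose r j : R := `|b j 0| / (1 + `|w j 0|).
have w1 j : 0 < 1 + `|w j 0| by rewrite ltr_pwDl.
exists (\big[Num.min/1]_(j | b j 0 != 0) r j).
  by apply: lt_bigmin => // j b0; rewrite divr_gt0 ?normr_gt0.
move=> j b0; rewrite (@le_trans _ _ (r j * `|w j 0|))//.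
  by rewrite ler_wpM2r//; apply: bigmin_le_cond.
rewrite /r mulrAC ler_pdivrMr// ler_wpM2l// lerDr ler01//.
Qed.

Lemma normrD_small (x h : R) : `|h| <= `|x| -> `|x + h| = `|x| + Num.sg x * h.
Proof.
case: (ltgtP x 0) => [x0|x0|->].
- rewrite ltr0_sg// (ltr0_norm x0) ler_norml => /andP[? ?].
  by rewrite ler0_norm; lra.
- rewrite gtr0_sg// (gtr0_norm x0) ler_norml => /andP[? ?].
  by rewrite ger0_norm; lra.
- by rewrite normr0 normr_le0 => /eqP ->; rewrite addr0 normr0 mulr0 addr0.
Qed.

Variables (Q : 'M[R]_p) (c : R).
Hypothesis Qsym : Q^T = Q.
Hypothesis c_gt0 : 0 < c.

(** The Gram matrix is invertible on the support of a unique minimizer: along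
    a kernel direction supported there, both the quadratic part and the
    penalty are affine near the minimizer, so by stationarity the objective
    would be constant. *)
Lemma unique_min_unitmx u b : kkt Q c u b ->
  (forall b', b' != b -> pobj Q c u b < pobj Q c u b') ->
  (embed (active_set b))^T *m Q *m embed (active_set b) \in unitmx.
Proof.
move=> bP bmin; set A := active_set b; set M := _ *m _.
have Msym : M^T = M by rewrite /M !trmx_mul trmxK Qsym mulmxA.
rewrite -row_free_unit -kermx_eq0; apply: contraT => /rowV0Pn[v].
move=> /sub_kermxP vM v0; pose w := embed A *m v^T.
have w0 : w != 0.
  apply: contraNneq v0 => w0; rewrite -[v]trmxK -(embedK v^T) -/w w0.
  by rewrite mulmx0 trmx0.
have wQw : dot w (Q *m w) = 0.
  have -> : dot w (Q *m w) = dot v^T (M *m v^T).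
    by rewrite /M -!mulmxA [RHS]dot_mulmx trmxK.
  rewrite -[M]Msym -trmx_mul vM trmx0.
  by rewrite /dot big1// => j _; rewrite !mxE mulr0.
have [t t0 tw] := small_step b w.
have btw : b + t *: w != b.
  by rewrite -subr_eq0 addrC addKr scaler_eq0 negb_or gt_eqF.
have := bmin _ btw.
rewrite pobj_shift// -scalemxAr dotZl !dotZr wQw !mulr0 addr0 -[2 * c * _]mulrA.
suff -> : c * (norm1 (b + t *: w) - norm1 b) = t * dot (u - Q *m b) w.
  by lra.
rewrite -sumrB !mulr_sumr; apply: eq_bigr => j _.
rewrite [(b + _) j 0]mxE [(t *: w) j 0]mxE.
have [b0|b0] := eqVneq (b j 0) 0.
  have -> : w j 0 = 0 by rewrite embed_notin// inE b0 eqxx.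
  by rewrite !mulr0 addr0 subrr mulr0.
rewrite normrD_small; last by rewrite normrM gtr0_norm// tw.
have /kktP/(_ j)[_ /(_ b0) ->] := bP; ring.
Qed.

Definition sol_op A : 'M[R]_p :=
  embed A *m invmx ((embed A)^T *m Q *m embed A) *m (embed A)^T.

(** On a given sign pattern the optimality conditions are a linear system. *)
Lemma kkt_solution u b : kkt Q c u b ->
  (embed (active_set b))^T *m Q *m embed (active_set b) \in unitmx ->
  b = sol_op (active_set b) *m (u - c *: pat_sign R (pattern b)).
Proof.
move=> bP Munit; rewrite /sol_op; set A := active_set b in Munit *.
have bA : embed A *m ((embed A)^T *m b) = b.
  by apply: embed_trmxK => j; rewrite inE negbK => /eqP.
rewrite -mulmxA -mulmxA -[LHS]bA; congr (_ *m _).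
have -> : (embed A)^T *m (u - c *: pat_sign R (pattern b)) =
    (embed A)^T *m (Q *m b).
  apply/colP => k; rewrite !trmx_embedE.
  have /kktP/(_ (enum_val k))[_ +] := bP.
  have := enum_valP k; rewrite inE => b0 /(_ b0) gE.
  have : (u - Q *m b) (enum_val k) 0 - c * Num.sg (b (enum_val k) 0) = 0.
    by rewrite gE subrr.
  rewrite -pat_signE !mxE; lra.
rewrite -[in RHS]bA (_ : _ *m (Q *m _) = (embed A)^T *m Q *m embed A *m
  ((embed A)^T *m b)); last by rewrite !mulmxA.
by rewrite mulKmx.
Qed.

End Support.

(** * The S-Lasso solution as a function of the response *)

Section Smoothness.
Variables (R : realType) (p : nat).

Lemma sum_next (j : 'I_p) (a : R) :
  \sum_(l < p | l == j.+1 :> nat) a = a *+ (j.+1 < p)%N.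
Proof.
case: ltnP => [jp|pj].
  by rewrite (big_pred1 (Ordinal jp)).
rewrite big_pred0 ?mulr0n// => l; apply/negP => /eqP lj.
by have := ltn_ord l; rewrite lj ltnNge pj.
Qed.

Lemma sum_prev (l : 'I_p) (a : R) :
  \sum_(j < p | l == j.+1 :> nat) a = a *+ (0 < l)%N.
Proof.
case: posnP => [l0|l_gt0].
  by rewrite big_pred0 ?mulr0n// => j; rewrite l0.
have lp : (l.-1 < p)%N by rewrite (leq_ltn_trans (leq_pred _)).
rewrite (big_pred1 (Ordinal lp)) // => j.
by rewrite /= -val_eqE/= -[in LHS](prednK l_gt0) eqSS eq_sym.
Qed.

Lemma smoothness_dot (b : 'cV[R]_p) : smoothness b = dot b (Jtilde R p *m b).
Proof.
have -> : smoothness b =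
    \sum_(j < p) \sum_(l < p | l == j.+1 :> nat) b l 0 ^+ 2
    + \sum_(j < p) \sum_(l < p | l == j.+1 :> nat) b j 0 ^+ 2
    - 2 * \sum_(j < p) \sum_(l < p | l == j.+1 :> nat) b j 0 * b l 0.
  rewrite mulr_sumr -!big_split -sumrB; apply: eq_bigr => j _.
  rewrite mulr_sumr -!big_split -sumrB; apply: eq_bigr => l _ /=; ring.
have -> : dot b (Jtilde R p *m b) =
    \sum_(j < p) (b j 0 ^+ 2 *+ (0 < j)%N + b j 0 ^+ 2 *+ (j.+1 < p)%N
      - \sum_(l < p | l == j.+1 :> nat) b j 0 * b l 0
      - \sum_(l < p | j == l.+1 :> nat) b j 0 * b l 0).
  apply: eq_bigr => j _; rewrite mxE mulr_sumr -mulrnDr.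
  pose k := ((0 < j) + (j.+1 < p))%N.
  have -> : b j 0 ^+ 2 *+ k = \sum_(l < p | l == j) b j 0 * b l 0 *+ k.
    by rewrite big_pred1_eq.
  rewrite [X in _ = X - _ - _]big_mkcond [X in _ = _ - X - _]big_mkcond.
  rewrite [X in _ = _ - X]big_mkcond -!sumrB; apply: eq_bigr => l _; rewrite mxE.
  rewrite (eq_sym j l); case: eqVneq => [->|_].
    by rewrite !ltn_eqF// !subr0 -mulr_natr -/k; ring.
  rewrite (eq_sym j.+1) (eq_sym l.+1); case: eqVneq => [lj|_] /=.
    by rewrite lj ltn_eqF ?subr0 1?ltnW//; ring.
  by case: ifP => _; ring.
rewrite !sumrB big_split /= [X in X + _ - _](exchange_big_dep xpredT)//=.
rewrite [X in _ - _ - X](exchange_big_dep xpredT)//=.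
under eq_bigr do rewrite sum_prev.
under [X in _ + X - _]eq_bigr do rewrite sum_next.
rewrite mulr2n mulrDl mul1r opprD addrA; congr (_ - _).
by apply: eq_bigr => j _; apply: eq_bigr => l _; rewrite mulrC.
Qed.

Lemma smoothness_ge0 (b : 'cV[R]_p) : 0 <= smoothness b.
Proof. by apply: sumr_ge0 => j _; apply: sumr_ge0 => l _; exact: sqr_ge0. Qed.

Lemma Jtilde_sym : (Jtilde R p)^T = Jtilde R p.
Proof.
apply/matrixP => i j; rewrite !mxE eq_sym [X in if _ then _ else if X then _ else _]orbC.
by case: eqVneq => [->|].
Qed.

End Smoothness.

Section SLassoSolution.
Variables (R : realType) (n p : nat) (X : 'M[R]_(n, p)) (lam mu : R).
Hypothesis n_gt0 : (0 < n)%N.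
Hypothesis lam_gt0 : 0 < lam.
Hypothesis mu_ge0 : 0 <= mu.

(** The quadratic part of [n] times the criterion. *)
Definition gram : 'M[R]_p := X^T *m X + (n%:R * mu) *: Jtilde R p.

(** Half of the penalty level of [n] times the criterion: [pobj] carries the
    factor 2 that differentiating the quadratic part produces. *)
Definition halfpen : R := n%:R * lam / 2.

Let nR_gt0 : 0 < n%:R :> R. Proof. by rewrite ltr0n. Qed.

Lemma halfpen_gt0 : 0 < halfpen.
Proof. by rewrite /halfpen !mulr_gt0 ?invr_gt0. Qed.

Lemma gram_sym : gram^T = gram.
Proof. by rewrite /gram linearD linearZ/= trmx_mul trmxK Jtilde_sym. Qed.

Lemma dot_gram h :
  dot h (gram *m h) = dot (X *m h) (X *m h) + n%:R * mu * smoothness h.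
Proof.
rewrite mulmxDl dotDr -scalemxAl dotZr -smoothness_dot -mulmxA.
by rewrite dot_mulmx trmxK.
Qed.

Lemma dot_gram_ge h : dot (X *m h) (X *m h) <= dot h (gram *m h).
Proof. by rewrite dot_gram lerDl !mulr_ge0 ?smoothness_ge0. Qed.

Lemma gram_psd h : 0 <= dot h (gram *m h).
Proof. by rewrite (le_trans (dot_ge0 _) (dot_gram_ge _)). Qed.

Lemma slasso_criterionE y b : slasso_criterion lam mu X y b =
  n%:R^-1 * (pobj gram halfpen (X^T *m y) b + dot y y).
Proof.
rewrite /slasso_criterion /sqnorm_n.
have -> : \sum_(i < n) `|(y - X *m b) i 0| ^+ 2 = dot (y - X *m b) (y - X *m b).
  by apply: eq_bigr => i _; rewrite -normrX ger0_norm ?sqr_ge0.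
rewrite !(dotDl, dotDr, dotNl, dotNr) (dotC (X *m b) y) /pobj dot_gram /halfpen.
rewrite (dot_mulmx X y); field.
by rewrite gt_eqF.
Qed.

Lemma is_slasso_kkt y b : is_slasso lam mu X y b ->
  kkt gram halfpen (X^T *m y) b.
Proof.
move=> bP; apply: (min_kkt gram_sym halfpen_gt0) => b'.
have [->//|b'b] := eqVneq b' b.
by have := bP _ b'b; rewrite !slasso_criterionE ltr_pM2l ?invr_gt0// ltrD2r => /ltW.
Qed.

Lemma is_slasso_unique y b b' : is_slasso lam mu X y b ->
  kkt gram halfpen (X^T *m y) b' -> b' = b.
Proof.
move=> bP b'P; apply/eqP; apply: contraT => /bP.
rewrite !slasso_criterionE ltr_pM2l ?invr_gt0// ltrD2r ltNge.
by rewrite (kkt_min gram_sym _ gram_psd b'P).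
Qed.

(** The point that [kkt_solution] predicts from the sign pattern alone. *)
Definition candidate (s : {set 'I_p} * {set 'I_p}) (y : 'cV[R]_n) : 'cV[R]_p :=
  sol_op gram (s.1 :|: s.2) *m (X^T *m y - halfpen *: pat_sign R s).

Lemma is_slasso_candidate y b : is_slasso lam mu X y b ->
  b = candidate (pattern b) y.
Proof.
move=> bP; have kb := is_slasso_kkt bP.
rewrite /candidate -active_pattern; apply: kkt_solution => //.
apply: (unique_min_unitmx gram_sym kb) => b' /bP.
by rewrite !slasso_criterionE ltr_pM2l ?invr_gt0// ltrD2r.
Qed.

Lemma df_hatE A : df_hat mu X A = \tr (X *m sol_op gram A *m X^T).
Proof.
rewrite /df_hat /sol_op !cols_embed principal_embed trmx_mul.
by rewrite /gram mulmxDr mulmxDl -scalemxAr -scalemxAl !mulmxA.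
Qed.

Variable bhat : 'cV[R]_n -> 'cV[R]_p.
Hypothesis bhatP : forall y, is_slasso lam mu X y (bhat y).

Lemma pattern_bhatP y s : pattern (bhat y) = s <->
  pattern (candidate s y) = s /\ kkt gram halfpen (X^T *m y) (candidate s y).
Proof.
split=> [<-|[sP kP]].
  by rewrite -is_slasso_candidate//; split => //; exact: is_slasso_kkt.
by rewrite -(is_slasso_unique (@bhatP y) kP).
Qed.

Lemma pattern_bhat_convex y1 y2 t : 0 <= t -> t <= 1 ->
  pattern (bhat y1) = pattern (bhat y2) ->
  pattern (bhat ((1 - t) *: y1 + t *: y2)) = pattern (bhat y2).
Proof.
move=> t0 t1 y12.
have [] := kkt_convex t0 t1 (is_slasso_kkt (@bhatP y1)) (is_slasso_kkt (@bhatP y2)) y12.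
rewrite !scalemxAr -mulmxDr => kP <-; congr pattern.
by rewrite -(is_slasso_unique (@bhatP _) kP).
Qed.

(** [kkt_monotone] with the quadratic form of [gram] bounded below by the
    squared norm of the fit: the fit is firmly nonexpansive. *)
Lemma fit_monotone y1 y2 :
  dot (X *m bhat y2 - X *m bhat y1) (X *m bhat y2 - X *m bhat y1) <=
  dot (y2 - y1) (X *m bhat y2 - X *m bhat y1).
Proof.
rewrite -mulmxBr.
apply: le_trans (dot_gram_ge _) _.
have := kkt_monotone gram_sym (is_slasso_kkt (@bhatP y1)) (is_slasso_kkt (@bhatP y2)).
by rewrite -mulmxBr (dot_mulmx X).
Qed.

Lemma bhat0 : bhat 0 = 0.
Proof.
apply/esym/(is_slasso_unique (@bhatP 0)) => j.
by rewrite !mulmx0 subr0 !mxE !normr0 !mulr0 ltW ?halfpen_gt0.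
Qed.

Lemma fit_norm_le y : dot (X *m bhat y) (X *m bhat y) <= dot y y.
Proof.
have := fit_monotone 0 y; rewrite bhat0 mulmx0 !subr0; set e := X *m _ => ey.
by have := dot_ge0 (y - e); rewrite !(dotDl, dotDr, dotNl, dotNr) (dotC e y); lra.
Qed.

(** When the responses differ only in coordinate [i], [fit_monotone] bounds the
    square of the [i]-th change by its product with [t]. *)
Lemma fit_coord_lipschitz y i t :
  `|(X *m bhat (y + t *: delta_mx i 0)) i 0 - (X *m bhat y) i 0| <= `|t|.
Proof.
have := fit_monotone y (y + t *: delta_mx i 0).
rewrite [y + _ - y]addrAC subrr add0r dotZl [dot (delta_mx _ _) _]dotC dot_delta.
set e := X *m _ - _.
have -> : (X *m bhat (y + t *: delta_mx i 0)) i 0 - (X *m bhat y) i 0 = e i 0.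
  by rewrite [RHS]mxE [(- (X *m bhat y)) i 0]mxE.
have e_i : `|e i 0| ^+ 2 <= dot e e.
  rewrite real_normK ?num_real// /dot (bigD1 i)//= lerDl sumr_ge0// => j _.
  exact: sqr_ge0.
move=> /(le_trans e_i)/le_trans/(_ (ler_norm _)); rewrite normrM expr2.
have [->|e0] := eqVneq (e i 0) 0; first by rewrite normr0.
by rewrite ler_pM2r// normr_gt0.
Qed.

End SLassoSolution.
(** * Integration against the centered Gaussian law *)

Section GaussianIntegral.
Variables (R : realType) (s : R).
Hypothesis s_gt0 : 0 < s.
Local Notation leb := (@lebesgue_measure R).
Local Notation N := (normal_prob (0 : R) s).
Local Notation phi := (normal_pdf (0 : R) s).

Lemma density_ae_eq : ae_eq leb setT (Radon_Nikodym_SigmaFinite.f N leb)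
  (fun x => (phi x)%:E).
Proof.
have Nleb := @normal_prob_dominates R 0 s.
apply: integral_ae_eq => //.
- exact: Radon_Nikodym_SigmaFinite.f_integrable.
- by apply/measurable_EFinP; exact: measurable_normal_pdf.
- by move=> E _ mE; rewrite -Radon_Nikodym_SigmaFinite.f_integral.
Qed.

Lemma ge0_integral_normal (f : R -> R) : (forall x, 0 <= f x) ->
  measurable_fun setT f ->
  (\int[N]_x (f x)%:E = \int[leb]_x (f x * phi x)%:E)%E.
Proof.
move=> f0 mf; have Nleb := @normal_prob_dominates R 0 s.
have mfE : measurable_fun setT (EFin \o f) by exact/measurable_EFinP.
rewrite -(Radon_Nikodym_SigmaFinite.change_of_variables Nleb)//.
apply: ae_eq_integral => //.
- apply: emeasurable_funM => //; apply: measurable_int.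
  exact: Radon_Nikodym_SigmaFinite.f_integrable.
- apply/measurable_EFinP/measurable_funM => //; exact: measurable_normal_pdf.
- under [X in ae_eq _ _ _ X]eq_fun do rewrite EFinM.
  by apply: ae_eqe_mul2l; exact: density_ae_eq.
Qed.

Lemma integrable_normalP (f : R -> R) : measurable_fun setT f ->
  N.-integrable setT (EFin \o f) <->
  leb.-integrable setT (fun x => (f x * phi x)%:E).
Proof.
move=> mf; have mfphi : measurable_fun setT (fun x => f x * phi x).
  by apply: measurable_funM => //; exact: measurable_normal_pdf.
have -> : N.-integrable setT (EFin \o f) <->
    (\int[N]_x `|f x|%:E < +oo)%E.
  split=> [/integrableP[_]//|fi]; apply/integrableP; split => //.
  exact/measurable_EFinP.
have -> : leb.-integrable setT (fun x => (f x * phi x)%:E) <->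
    (\int[leb]_x (`|f x| * phi x)%:E < +oo)%E.
  have -> : (\int[leb]_x (`|f x| * phi x)%:E =
      \int[leb]_x `|(f x * phi x)%:E|)%E.
    by apply: eq_integral => x _ /=; rewrite normrM (ger0_norm (normal_pdf_ge0 _ _ _)).
  split=> [/integrableP[_]//|fi]; apply/integrableP; split => //.
  exact/measurable_EFinP.
by rewrite ge0_integral_normal//; apply: measurableT_comp.
Qed.

Lemma integral_normal (f : R -> R) : N.-integrable setT (EFin \o f) ->
  (\int[N]_x (f x)%:E = \int[leb]_x (f x * phi x)%:E)%E.
Proof.
move=> fi; have Nleb := @normal_prob_dominates R 0 s.
have mf : measurable_fun setT f by apply/measurable_EFinP; exact: measurable_int fi.
have mfE : measurable_fun setT (EFin \o f) by exact/measurable_EFinP.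
rewrite -(Radon_Nikodym_change_of_variables Nleb measurableT fi).
apply: ae_eq_integral => //.
- exact: emeasurable_funM.
- apply/measurable_EFinP/measurable_funM => //; exact: measurable_normal_pdf.
- under [X in ae_eq _ _ _ X]eq_fun do rewrite EFinM.
  apply: ae_eqe_mul2l; apply: (ae_eq_trans _ density_ae_eq).
  by apply: ae_eq_sym; exact: ae_eq_Radon_Nikodym_SigmaFinite.
Qed.

(** The bound [u <= expR u] at [u = x ^+ 2 / (4 * s ^+ 2)] trades the factor
    [x ^+ 2] for a doubling of the variance. *)
Lemma sqr_normal_pdf_le : exists2 C : R, 0 <= C & forall x,
  x ^+ 2 * phi x <= C * normal_pdf 0 (Num.sqrt 2 * s) x.
Proof.
have s2_gt0 : 0 < Num.sqrt 2 * s by rewrite mulr_gt0 ?sqrtr_gt0.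
have pk : 0 < normal_peak (Num.sqrt 2 * s) by rewrite normal_peak_gt0 ?gt_eqF.
exists (4 * s ^+ 2 * normal_peak s / normal_peak (Num.sqrt 2 * s)).
  by rewrite divr_ge0 ?normal_peak_ge0// !mulr_ge0 ?normal_peak_ge0// ltW.
move=> x; rewrite !normal_pdfE ?gt_eqF//.
rewrite [leRHS]mulrA divfK ?gt_eqF// [leLHS]mulrCA.
rewrite [4 * _ * normal_peak s]mulrC -[leRHS]mulrA.
rewrite ler_wpM2l ?normal_peak_ge0//.
rewrite /normal_fun !subr0 exprMn sqr_sqrtr//.
have -> : - x ^+ 2 / (s ^+ 2 *+ 2) =
    - (x ^+ 2 / (4 * s ^+ 2)) + - x ^+ 2 / (2 * s ^+ 2 *+ 2).
  by field; rewrite gt_eqF.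
rewrite expRD mulrA ler_wpM2r ?expR_ge0// expRN ler_pdivrMr ?expR_gt0//.
have u := expR_ge1Dx (x ^+ 2 / (4 * s ^+ 2)).
have s4 : 0 < 4 * s ^+ 2 by rewrite mulr_gt0// exprn_gt0.
rewrite mulrC -ler_pdivrMr//; exact: le_trans (ltW (ltr_pwDl ltr01 (lexx _))) u.
Qed.

Lemma integrable_sqr_normal : N.-integrable setT (EFin \o (fun x => x ^+ 2)).
Proof.
apply/integrable_normalP; first exact: measurable_funX.
have [C C0 HC] := sqr_normal_pdf_le.
have Ci : leb.-integrable setT
    (fun x => (C%:E * (normal_pdf 0 (Num.sqrt 2 * s) x)%:E)%E).
  by apply: integrableZl => //; exact: integrable_normal_pdf.
apply: (le_integrable measurableT _ _ Ci).
- apply/measurable_EFinP/measurable_funM; last exact: measurable_normal_pdf.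
  exact: measurable_funX.
- move=> x _; rewrite -EFinM lee_fin ger0_norm.
    by rewrite (le_trans (HC x))// ler_norm.
  by rewrite mulr_ge0 ?sqr_ge0 ?normal_pdf_ge0.
Qed.

End GaussianIntegral.

Section GaussianLaw.
Variables (R : realType) (s : R).
Local Notation N := (normal_prob (0 : R) s).

(** The identity between the two Borel structures that the real line carries,
    the one on which the Lebesgue measure lives and the default one. *)
Definition lebesgue_to_borel : measurableTypeR R -> R := idfun.

Lemma measurable_lebesgue_to_borel : measurable_fun setT lebesgue_to_borel.
Proof. by move=> _ A mA; rewrite setTI. Qed.

HB.instance Definition _ := isMeasurableFun.Build _ _ _ _ lebesgue_to_borel
  measurable_lebesgue_to_borel.

Definition gaussian_law : probability R R :=
  distribution N lebesgue_to_borel.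

Lemma integral_gaussian_law (f : R -> \bar R) : measurable_fun setT f ->
  N.-integrable setT f -> (\int[gaussian_law]_t f t = \int[N]_t f t)%E.
Proof. by move=> mf fi; rewrite integral_distribution. Qed.

Lemma integrable_gaussian_law (f : R -> \bar R) : measurable_fun setT f ->
  N.-integrable setT f -> gaussian_law.-integrable setT f.
Proof.
move=> mf fi; exact: (integrable_pushforward measurable_lebesgue_to_borel).
Qed.

End GaussianLaw.

(** * Stein's identity in one variable *)

Section FiniteCases.
Context d (U : measurableType d) (R : realType) (S : finType) (pat : U -> S).
Hypothesis pat_measurable : forall s, measurable (pat @^-1` [set s]).

Lemma measurable_fun_cases (F : S -> U -> R) :
  (forall s, measurable_fun setT (F s)) ->
  measurable_fun setT (fun z => F (pat z) z).
Proof.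
move=> mF; have -> : (fun z => F (pat z) z) =
    (fun z => \sum_(s : S) \1_(pat @^-1` [set s]) z * F s z).
  apply/funext => z; rewrite (bigD1 (pat z))//= indicE mem_set// mul1r.
  rewrite big1 ?addr0// => s /eqP sz; rewrite indicE memNset ?mul0r//.
  by move=> /= /esym.
by apply: measurable_sum => s; apply: measurable_funM.
Qed.

End FiniteCases.

Lemma finite_values_bounded (R : realType) (S : finType) (F : S -> R) :
  exists M : R, forall s, `|F s| <= M.
Proof.
by exists (\sum_s `|F s|) => s; rewrite (bigD1 s)//= lerDl sumr_ge0.
Qed.

Lemma bounded_integrable d (U : measurableType d) (R : realType)
    (P : probability U R) (f : U -> R) (M : R) : measurable_fun setT f ->
  (forall z, `|f z| <= M) -> P.-integrable setT (EFin \o f).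
Proof.
move=> mf fM; apply: (@le_integrable _ _ _ _ _ measurableT _ (EFin \o cst M)).
- exact/measurable_EFinP.
- by move=> z _ /=; rewrite lee_fin (le_trans (fM z))// ler_norm.
- exact: finite_measure_integrable_cst.
Qed.

Section Stein.
Variables (R : realType) (sigma : R).
Hypothesis sigma_gt0 : 0 < sigma.
Local Notation leb := (@lebesgue_measure R).
Local Notation N := (normal_prob (0 : R) sigma).
Local Notation phi := (normal_pdf (0 : R) sigma).

Lemma is_derive_normal_pdf (x : R) :
  is_derive x 1 phi (- (x / sigma ^+ 2) * phi x).
Proof.
rewrite normal_pdfE ?gt_eqF// /normal_fun.
apply: is_derive_eq; rewrite /GRing.scale /= !subr0.
by field; rewrite gt_eqF.
Qed.

(** [t |-> (a * t + b) * phi t] is a primitive of the integrand, because the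
    Gaussian density satisfies [phi' t = - t / sigma ^+ 2 * phi t]. *)
Lemma affine_stein_itv (a b x y : R) : x < y ->
  (\int[leb]_(t in `[x, y])
     ((a - t * (a * t + b) / sigma ^+ 2) * phi t)%:E =
  ((a * y + b) * phi y)%:E - ((a * x + b) * phi x)%:E)%E.
Proof.
move=> xy; pose F t := (a * t + b) * phi t.
pose f t := (a - t * (a * t + b) / sigma ^+ 2) * phi t.
have dF (t : R) : is_derive t 1 F (f t).
  have dphi := is_derive_normal_pdf t.
  by apply: is_derive_eq; rewrite /GRing.scale/= /f; ring.
have cF (t : R) : {for t, continuous F}.
  by apply/differentiable_continuous/derivable1_diffP; have [] := dF t.
apply: (@continuous_FTC2 _ f F) => //.
- apply: continuous_subspaceT => t.
  have cphi : {for t, continuous phi} by apply: continuous_normal_pdf; rewrite gt_eqF.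
  apply: cvgM => //; apply: cvgB; first exact: cvg_cst.
  apply: cvgM; last exact: cvg_cst.
  apply: cvgM; first exact: cvg_id.
  apply: cvgD; last exact: cvg_cst.
  by apply: cvgM; [exact: cvg_cst|exact: cvg_id].
- split=> [t _||].
  + by have [] := dF t.
  + by apply: cvg_at_right_filter; exact: cF.
  + by apply: cvg_at_left_filter; exact: cF.
- by move=> t _; rewrite derive1E; apply: derive_val.
Qed.

Section PiecewiseAffine.
Variables (S : finType) (pat : R -> S) (slope icpt : S -> R) (g : R -> R) (K : R).
Hypothesis gE : forall t, g t = slope (pat t) * t + icpt (pat t).
Hypothesis pat_convex : forall x y z,
  x <= y -> y <= z -> pat x = pat z -> pat y = pat x.
Hypothesis g_cont : continuous g.
Hypothesis g_le : forall t, `|g t| <= K + `|t|.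

Let psi t := (slope (pat t) - t * g t / sigma ^+ 2) * phi t.

Lemma pat_interval s : is_interval (pat @^-1` [set s]).
Proof.
move=> x z /= xs zs y /andP[xy yz].
by rewrite (pat_convex xy yz) ?xs ?zs.
Qed.

Lemma measurable_slope : measurable_fun setT (slope \o pat).
Proof.
apply: (@measurable_fun_cases _ _ _ _ pat _ (fun s _ => slope s)) => s.
  exact: (is_interval_measurable (@pat_interval s)).
exact: measurable_cst.
Qed.

Lemma g_measurable : measurable_fun setT g.
Proof. exact: continuous_measurable_fun. Qed.

Lemma measurable_psi : measurable_fun setT psi.
Proof.
apply: measurable_funM; last exact: measurable_normal_pdf.
apply: measurable_funB; first exact: measurable_slope.
apply: measurable_funM => //; apply: measurable_funM => //.
exact: g_measurable.
Qed.

(** Right ends of the pattern intervals suffice: of two points with different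
    patterns, the left one leaves its own interval before the right one. The
    supremum of an unbounded or empty interval is a harmless extra point. *)
Definition breakpoints : seq R := [seq sup (pat @^-1` [set s]) | s <- enum S].

Lemma breakpoint_between t u : t < u -> pat t != pat u ->
  exists2 e, e \in breakpoints & t <= e <= u.
Proof.
move=> tu ptu; pose I := pat @^-1` [set pat t].
have uI : ubound I u.
  move=> x /= xt; rewrite leNgt; apply/negP => ux.
  by case/eqP: ptu; rewrite (pat_convex (ltW tu) (ltW ux)).
exists (sup I); first by apply: map_f; rewrite mem_enum.
by rewrite ub_le_sup//=; [apply: ge_sup => //; exists t|exists u].
Qed.

(** Without a breakpoint inside, [g] is a single affine function on the open
    interval, and by continuity also at both ends. *)
Lemma stein_no_breakpoint x y : x < y ->
  {in breakpoints, forall e, ~~ (x < e < y)} ->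
  (\int[leb]_(t in `[x, y]) (psi t)%:E =
   (g y * phi y)%:E - (g x * phi x)%:E)%E.
Proof.
move=> xy nobp; pose s := pat ((x + y) / 2).
have pat_s t : x < t < y -> pat t = s.
  have mid : x < (x + y) / 2 < y by rewrite !midf_lt.
  move=> xty; apply/eqP; apply/negPn/negP => ts.
  have [e eb] : exists2 e, e \in breakpoints &
      Num.min t ((x + y) / 2) <= e <= Num.max t ((x + y) / 2).
    case: (ltgtP t ((x + y) / 2)) => [tm|tm|tm].
    - exact: breakpoint_between.
    - by apply: breakpoint_between => //; rewrite eq_sym.
    - by rewrite /s tm eqxx in ts.
  apply/negP; rewrite negb_and -!ltNge; have := nobp _ eb.
  case/andP: xty => xt ty; case/andP: mid => xm my.
  rewrite negb_and -!leNgt => /orP[ex|ye].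
    by rewrite (le_lt_trans ex)// lt_min xt xm.
  by rewrite (lt_le_trans _ ye) ?orbT// gt_max ty my.
pose h t := slope s * t + icpt s.
have h_cont : continuous h.
  move=> t; apply: cvgD; last exact: cvg_cst.
  by apply: cvgM; [exact: cvg_cst|exact: cvg_id].
have gh t : x < t < y -> g t = h t by move=> /pat_s ts; rewrite gE ts.
have gx : g x = h x.
  apply: (@cvg_unique _ _ (g @ x^'+)) => //.
    by apply: cvg_at_right_filter; exact: g_cont.
  apply: cvg_trans (cvg_at_right_filter (h_cont x)).
  apply: near_eq_cvg; near=> t; apply/esym/gh; apply/andP; split=> //.
have gy : g y = h y.
  apply: (@cvg_unique _ _ (g @ y^'-)) => //.
    by apply: cvg_at_left_filter; exact: g_cont.
  apply: cvg_trans (cvg_at_left_filter (h_cont y)).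
  apply: near_eq_cvg; near=> t; apply/esym/gh; apply/andP; split=> //.
rewrite gx gy -affine_stein_itv//; apply: eq_integral_itv_bounded.
- by apply: measurable_funTS; exact: measurable_psi.
- apply: measurable_funTS; apply: measurable_funM; last exact: measurable_normal_pdf.
  apply: measurable_funB => //; apply: measurable_funM => //.
  apply: measurable_funM => //.
  exact: continuous_measurable_fun.
- move=> t; rewrite in_itv/= => txy.
  by rewrite /psi (pat_s _ txy) (gh _ txy).
Unshelve. all: by end_near. Qed.

(** The breakpoints are removed one at a time by cutting the interval there;
    the boundary terms at a cut cancel. *)
Lemma stein_itv x y : x < y ->
  (\int[leb]_(t in `[x, y]) (psi t)%:E =
   (g y * phi y)%:E - (g x * phi x)%:E)%E.
Proof.
suff H (E : seq R) a b : a < b ->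
    {in breakpoints, forall e, a < e < b -> e \in E} ->
    (\int[leb]_(t in `[a, b]) (psi t)%:E =
     (g b * phi b)%:E - (g a * phi a)%:E)%E.
  by move=> xy; apply: (H breakpoints).
elim: E a b => [|e E IH] a b ab Eb.
  by apply: stein_no_breakpoint => // e eb; apply/negP => /(Eb _ eb).
have [/andP[ae eb]|abNe] := boolP (a < e < b); last first.
  apply: IH => // e' e'b aeb'; have := Eb _ e'b aeb'.
  by rewrite inE => /predU1P[e'e|//]; rewrite -e'e aeb' in abNe.
have E1 : {in breakpoints, forall e', a < e' < e -> e' \in E}.
  move=> e' e'b /andP[ae' e'e]; have := Eb _ e'b.
  by rewrite ae' (lt_trans e'e eb) inE lt_eqF//= => ->.
have E2 : {in breakpoints, forall e', e < e' < b -> e' \in E}.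
  move=> e' e'b /andP[ee' e'b']; have := Eb _ e'b.
  by rewrite e'b' (lt_trans ae ee') inE gt_eqF//= => ->.
have mpsi := measurable_psi.
have -> : `[a, b]%classic = `[a, e]%classic `|` `]e, b]%classic.
  by rewrite -itv_bndbnd_setU// bnd_simp ltW.
rewrite integral_setU//=; last 2 first.
  by apply/measurable_EFinP; exact: measurable_funTS.
  apply/disj_setPS => t [] /=; rewrite !in_itv/= => /andP[_ te] /andP[et _].
  by move: (lt_le_trans et te); rewrite ltxx.
rewrite integral_itv_obnd_cbnd; last first.
  by apply/measurable_EFinP; exact: measurable_funTS.
rewrite (IH _ _ ae E1) (IH _ _ eb E2) -!EFinB -EFinD; congr EFin; ring.
Qed.

Lemma integrable_slope : N.-integrable setT (EFin \o (slope \o pat)).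
Proof.
have [M HM] := finite_values_bounded slope.
apply: (@bounded_integrable _ (measurableTypeR R) R (normal_prob 0 sigma) _ M).
  exact: measurable_slope.
by move=> t; exact: HM.
Qed.

Lemma integrable_mul_id : N.-integrable setT (EFin \o (fun t => t * g t)).
Proof.
have bound_int : N.-integrable setT
    (EFin \o (fun t => `|K| + (`|K| + 1) * t ^+ 2)).
  have -> : EFin \o (fun t => `|K| + (`|K| + 1) * t ^+ 2) =
      ((EFin \o cst `|K|%R) \+ (fun t => (`|K| + 1)%:E * (t ^+ 2)%:E))%E by [].
  apply: integrableD => //; first exact: finite_measure_integrable_cst.
  by apply: integrableZl => //; exact: integrable_sqr_normal.
apply: (le_integrable measurableT _ _ bound_int).
- apply/measurable_EFinP; apply: measurable_funM => //; exact: g_measurable.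
- move=> t _; rewrite lee_fin normrM.
  apply: le_trans (ler_norm _).
  apply: le_trans (ler_wpM2l (normr_ge0 _) (g_le t)) _.
  have Kn := ler_norm K; have K0 := normr_ge0 K.
  rewrite -(real_normK (num_real t)); have := normr_ge0 t.
  set a := `|t|; set k := `|K| in Kn K0 * => a0.
  rewrite -subr_ge0; have -> : k + (k + 1) * a ^+ 2 - a * (K + a) =
    k * (1 - a) ^+ 2 + a * (k + (k - K)) by ring.
  apply: addr_ge0; apply: mulr_ge0 => //; first exact: sqr_ge0.
  by apply: addr_ge0 => //; rewrite subr_ge0.
Qed.

Let integrable_psi : leb.-integrable setT (fun t => (psi t)%:E).
Proof.
have mpsi0 : measurable_fun setT
    (fun t => slope (pat t) - t * g t / sigma ^+ 2).
  apply: measurable_funB; first exact: measurable_slope.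
  by apply: measurable_funM => //; apply: measurable_funM => //; exact: g_measurable.
apply/integrable_normalP => //.
have -> : EFin \o (fun t => slope (pat t) - t * g t / sigma ^+ 2) =
    ((EFin \o (slope \o pat)) \-
     (fun t => (sigma ^- 2)%:E * (t * g t)%:E))%E.
  by apply/funext => t /=; rewrite [_ / _]mulrC.
apply: integrableB => //; first exact: integrable_slope.
by apply: integrableZl => //; exact: integrable_mul_id.
Qed.

(** [g] grows at most linearly, and [x ^+ 2 * phi x] is bounded. *)
Let boundary_cvg0 :
  (g n.+1%:R * phi n.+1%:R - g (- n.+1%:R) * phi (- n.+1%:R)) @[n --> \oo] --> (0 : R).
Proof.
have [C C0 HC] := sqr_normal_pdf_le sigma_gt0.
pose P := normal_peak (Num.sqrt 2 * sigma).
have P0 : 0 <= P by exact: normal_peak_ge0.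
have bound (x : R) : 1 <= `|x| -> `|g x * phi x| <= (`|K| + 1) * (C * P) * `|x|^-1.
  move=> x1; have x0 : 0 < `|x| := lt_le_trans ltr01 x1.
  rewrite normrM (ger0_norm (normal_pdf_ge0 _ _ _)) ler_pdivlMr//.
  have gx : `|g x| <= (`|K| + 1) * `|x|.
    apply: le_trans (g_le x) _; rewrite mulrDl mul1r lerD2r.
    by apply: le_trans (ler_norm _) _; rewrite ler_peMr.
  have phx : x ^+ 2 * phi x <= C * P.
    apply: le_trans (HC x) _; rewrite ler_wpM2l// normal_pdf_ub//.
    by rewrite gt_eqF// mulr_gt0 ?sqrtr_gt0.
  apply: (@le_trans _ _ ((`|K| + 1) * (x ^+ 2 * phi x))); last first.
    by rewrite ler_wpM2l ?addr_ge0.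
  rewrite -(real_normK (num_real x)).
  have := ler_wpM2r (mulr_ge0 (normal_pdf_ge0 0 sigma x) (ltW x0)) gx.
  lra.
have bd n : `|g n.+1%:R * phi n.+1%:R - g (- n.+1%:R) * phi (- n.+1%:R)|
    <= (2 * ((`|K| + 1) * (C * P))) * n.+1%:R^-1.
  have b1 := bound n.+1%:R; have b2 := bound (- n.+1%:R).
  rewrite normrN in b2; rewrite ger0_norm// in b1 b2.
  have n1 : 1 <= n.+1%:R :> R by rewrite ler1n.
  apply: le_trans (ler_normB _ _) _; apply: le_trans (lerD (b1 n1) (b2 n1)) _.
  by rewrite -mulrDl -mulr2n -[_ *+ 2]mulr_natl.
have lim0 : ((2 * ((`|K| + 1) * (C * P))) * n.+1%:R^-1) @[n --> \oo] --> (0 : R).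
  rewrite -[X in _ --> X](mulr0 (2 * ((`|K| + 1) * (C * P)))).
  by apply: cvgM; [exact: cvg_cst|exact: cvg_harmonic].
apply/cvgr0Pnorm_le => e e0; have := lim0.
move=> /cvgr0_norm_le/(_ e e0); apply: filterS => n.
by apply: le_trans; apply: le_trans (bd n) (ler_norm _).
Qed.

(** [psi] is the derivative of [g * phi] away from the breakpoints, and
    [g * phi] vanishes at infinity; dominated convergence passes from the
    intervals [[- n.+1, n.+1]] to the line. *)
Lemma integral_psi0 : (\int[leb]_t (psi t)%:E = 0)%E.
Proof.
pose D n : set R := `[- n.+1%:R, n.+1%:R]%classic.
pose f_ n := (fun t => (psi t)%:E) \_ (D n).
have mpsiE : measurable_fun setT (fun t => (psi t)%:E).
  by apply/measurable_EFinP; exact: measurable_psi.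
have mf_ n : measurable_fun setT (f_ n).
  have := (measurable_restrictT (fun t => (psi t)%:E)
    (measurable_itv `[- n.+1%:R, n.+1%:R])).1.
  by apply; exact: measurable_funTS.
have H1 : {ae leb, forall t, setT t -> f_ ^~ t @ \oo --> (psi t)%:E}.
  apply: aeW => t _; apply: cvg_near_cst.
  exists (Num.truncn `|t|) => //= n /= tn.
  rewrite /f_ patchE mem_set// /D /= in_itv/= -ler_norml.
  by rewrite ltW// (lt_le_trans (truncnS_gt _))// ler_nat ltnS.
have H2 : {ae leb, forall t n, setT t -> (`|f_ n t| <= `|(psi t)%:E|)%E}.
  apply: aeW => t n _; rewrite /f_ patchE; case: ifP => // _.
  by rewrite abse0 abse_ge0.
have [_ _] := @dominated_convergence _ _ _ leb setT measurableT f_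
  (fun t => (psi t)%:E) (fun t => `|(psi t)%:E|%E) mf_ mpsiE H1
  (integrable_abse integrable_psi) H2.
rewrite /=.
have -> : (fun n => \int[leb]_x f_ n x)%E = (fun n => (g n.+1%:R * phi n.+1%:R -
    g (- n.+1%:R) * phi (- n.+1%:R))%:E).
  apply/funext => n; rewrite /f_ -integral_mkcond.
  rewrite stein_itv ?EFinB// -subr_gt0 opprK.
  by rewrite addr_gt0.
move=> /cvg_unique; apply => //.
by apply: cvg_EFin; [exact: nearW|exact: boundary_cvg0].
Qed.

(** [integral_psi0] multiplied by [sigma ^+ 2]. *)
Lemma stein_piecewise_affine :
  (\int[gaussian_law sigma]_t (t * g t)%:E =
   \int[gaussian_law sigma]_t (sigma ^+ 2 * slope (pat t))%:E)%E.
Proof.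
have slope_int : N.-integrable setT
    (fun t => (sigma ^+ 2 * slope (pat t))%:E).
  under [X in integrable _ _ X]eq_fun do rewrite EFinM.
  by apply: integrableZl => //; exact: integrable_slope.
rewrite !integral_gaussian_law//; last 3 first.
- exact: measurable_int slope_int.
- exact: measurable_int integrable_mul_id.
- exact: integrable_mul_id.
have psi_int : N.-integrable setT
    (EFin \o (fun t => slope (pat t) - t * g t / sigma ^+ 2)).
  apply/integrable_normalP => //.
  apply: measurable_funB; first exact: measurable_slope.
  by apply: measurable_funM => //; apply: measurable_funM => //; exact: g_measurable.
have s2 : sigma ^+ 2 != 0 by rewrite expf_neq0// gt_eqF.
have -> : (\int[N]_t (t * g t)%:E = \int[N]_t ((sigma ^+ 2 * slope (pat t))%:E
    - (sigma ^+ 2)%:E * (slope (pat t) - t * g t / sigma ^+ 2)%:E))%E.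
  by apply: eq_integral => t _; rewrite -EFinM -EFinB; congr EFin; field; rewrite gt_eqF.
rewrite integralB//.
- rewrite [X in (_ - X)%E]integralZl// [X in (_ - _ * X)%E]integral_normal//.
  by rewrite integral_psi0 mule0 sube0.
- exact: integrableZl.
Qed.

End PiecewiseAffine.

End Stein.
(** * Independent Gaussian vectors: resampling one coordinate *)

Section Boxes.
Variables (R : realType) (n : nat).
Local Notation vec := (n.-tuple R).

Definition box (B : 'I_n -> set R) : set vec :=
  [set z | forall j, B j (tnth z j)].

Definition boxes : set (set vec) :=
  [set A | exists2 B : 'I_n -> set R, (forall j, measurable (B j)) & A = box B].

Lemma box_bigcap B : box B =
  \bigcap_(j in [set` [set: 'I_n]%SET]) ((fun z : vec => tnth z j) @^-1` B j).
Proof.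
by apply/seteqP; split=> z /= zB j; [move=> _; exact: zB|apply: zB => /=; rewrite inE].
Qed.

Lemma measurable_box B : (forall j, measurable (B j)) -> measurable (box B).
Proof.
move=> mB; rewrite box_bigcap; apply: fin_bigcap_measurable => // j _.
by rewrite -[X in measurable X]setTI; exact: measurable_tnth.
Qed.

Lemma measurable_boxes : @measurable _ vec = <<s boxes >>.
Proof.
apply/seteqP; split; last first.
  apply: smallest_sub; first exact: sigma_algebra_measurable.
  by move=> _ [B mB ->]; exact: measurable_box.
apply: smallest_sub; first exact: smallest_sigma_algebra.
rewrite -bigcup_seq => A [j /= _ [B mB <-]]; rewrite setTI.
apply: sub_sigma_algebra; exists (fun k => if k == j then B else setT).
  by move=> k; case: ifP.
apply/seteqP; split=> z /=.
  by move=> zB k; case: eqP => [->|].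
by move=> /(_ j); rewrite eqxx.
Qed.

Lemma boxes_setI : setI_closed boxes.
Proof.
move=> _ _ [A mA ->] [B mB ->]; exists (fun j => A j `&` B j).
  by move=> j; exact: measurableI.
by apply/seteqP; split=> z /=; [move=> [zA zB] j|move=> zAB; split=> j; case: (zAB j)].
Qed.

Definition update (i : 'I_n) (z : vec) (t : R) : vec :=
  [tuple if j == i then t else tnth z j | j < n].

Lemma update_id i z t : tnth (update i z t) i = t.
Proof. by rewrite tnth_mktuple eqxx. Qed.

Lemma measurable_update i :
  measurable_fun setT (fun zt : vec * R => update i zt.1 zt.2).
Proof.
apply/measurable_fun_tnthP => j; rewrite /comp.
under eq_fun do rewrite tnth_mktuple.
case: eqP => _; first exact: measurable_snd.
exact: (measurableT_comp (measurable_tnth j) measurable_fst).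
Qed.

End Boxes.

Section Resampling.
Variables (R : realType) (n : nat) (nu : probability (n.-tuple R) R).
Variables (N : probability R R) (i : 'I_n).
Local Notation vec := (n.-tuple R).
Hypothesis nu_box : forall B : 'I_n -> set R, (forall j, measurable (B j)) ->
  nu (box B) = (\prod_(j < n) N (B j))%E.

(** It suffices to compare the two laws on boxes, where the probability of the
    [i]-th side factors out of both. *)
Lemma resample_law (A : set vec) : measurable A ->
  (nu \x N)%E ((fun zt : vec * R => update i zt.1 zt.2) @^-1` A) = nu A.
Proof.
pose upd (zt : vec * R) := update i zt.1 zt.2.
move=> mA.
pose pf_ : {measure set vec -> \bar R} := pushforward (nu \x N)%E upd.
pose pf := pf_ (measurable_update i).
suff : pf A = nu A by [].
apply: (measure_unique (@boxes R n) (fun=> setT)) => //.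
- exact: measurable_boxes.
- exact: boxes_setI.
- by exists (fun=> setT) => //; apply/seteqP.
- by apply/seteqP; split=> // z _; exists 0%N.
- move=> _ [B mB ->].
  pose B' j := if j == i then setT else B j.
  have mB' j : measurable (B' j) by rewrite /B'; case: ifP.
  have -> : pf (box B) = (nu \x N)%E (box B' `*` B i).
    rewrite /pf /pf_ /= /pushforward; congr ((_ \x _)%E _).
    apply/seteqP; split=> [[z t] /= zB|[z t] /= [zB tB] j].
      split=> [j|]; last by have := zB i; rewrite update_id.
      by rewrite /B'; have := zB j; rewrite tnth_mktuple; case: eqP.
    rewrite tnth_mktuple; case: eqP => [->//|/eqP/negbTE ji].
    by have := zB j; rewrite /B' ji.
  have -> : (nu \x N)%E (box B' `*` B i) = (nu (box B') * N (B i))%E.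
    by apply: product_measure1E => //; exact: measurable_box.
  rewrite [RHS](_ : _ = \prod_(j < n) N (B j))%E; last exact: nu_box.
  rewrite (nu_box mB') (bigD1 i)//= [RHS](bigD1 i)//= /B' eqxx probability_setT mul1e.
  rewrite muleC; congr (_ * _)%E.
  by apply: eq_bigr => j /negbTE ->.
- by move=> k; rewrite /pf /pf_ /= /pushforward preimage_setT probability_setT ltry.
Qed.

(** [resample_law] and Fubini's theorem: integrating over coordinate [i] with
    the others frozen comes first. *)
Lemma integral_resample (h : vec -> R) : nu.-integrable setT (EFin \o h) ->
  (\int[nu]_z (h z)%:E = \int[nu]_z \int[N]_t (h (update i z t))%:E)%E.
Proof.
move=> hi; have mh := measurable_int _ hi.
pose upd (zt : vec * R) := update i zt.1 zt.2.
have updE : (\int[nu]_z `|(h z)%:E| =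
    \int[nu \x N]_zt `|(h (update i zt.1 zt.2))%:E|)%E.
  transitivity (\int[pushforward (nu \x N)%E upd]_z `|(h z)%:E|)%E.
    apply: eq_measure_integral => [|mupd A mA _]; first exact: measurable_update.
    by apply: esym; exact: resample_law.
  rewrite (ge0_integral_pushforward (measurable_update i)) ?preimage_setT//.
  exact: measurableT_comp.
have mhu : measurable_fun setT (fun zt : vec * R => (h (update i zt.1 zt.2))%:E).
  exact: (measurableT_comp mh (measurable_update i)).
have hui : (nu \x N)%E.-integrable setT (fun zt : vec * R => (h (update i zt.1 zt.2))%:E).
  by apply/integrableP; split => //; rewrite -updE; case/integrableP: hi.
have -> : (\int[nu]_z (h z)%:E =
    \int[nu \x N]_zt (h (update i zt.1 zt.2))%:E)%E.
  transitivity (\int[pushforward (nu \x N)%E upd]_z (h z)%:E)%E.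
    apply: eq_measure_integral => [|mupd A mA _]; first exact: measurable_update.
    by apply: esym; exact: resample_law.
  by rewrite (integral_pushforward (measurable_update i)) ?preimage_setT.
by rewrite -integral12_prod_meas1.
Qed.

End Resampling.

(** * The S-Lasso fit at a random response *)

Section MeasurableVectors.
Context d (U : measurableType d) (R : realType).

Definition measurable_cV m (F : U -> 'cV[R]_m) : Prop :=
  forall j, measurable_fun setT (fun z => F z j 0).

Lemma measurable_cV_cst m (v : 'cV[R]_m) : measurable_cV (cst v).
Proof. by move=> j; exact: measurable_cst. Qed.

Lemma measurable_cVB m (F G : U -> 'cV[R]_m) : measurable_cV F ->
  measurable_cV G -> measurable_cV (fun z => F z - G z).
Proof.
move=> mF mG j.
have -> : (fun z => (F z - G z) j 0) = (fun z => F z j 0 - G z j 0).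
  by apply/funext => z; rewrite !mxE.
exact: measurable_funB.
Qed.

Lemma measurable_mulmx m l (A : 'M[R]_(l, m)) (F : U -> 'cV[R]_m) :
  measurable_cV F -> measurable_cV (fun z => A *m F z).
Proof.
move=> mF j.
have -> : (fun z => (A *m F z) j 0) = (fun z => \sum_k A j k * F z k 0).
  by apply/funext => z; rewrite mxE.
by apply: measurable_sum => k; apply: measurable_funM.
Qed.

Lemma measurable_bool_set (b : U -> bool) : measurable_fun setT b ->
  measurable [set z | b z].
Proof.
move=> mb; have -> : [set z | b z] = setT `&` b @^-1` [set true].
  by rewrite setTI; apply/seteqP; split.
exact: mb.
Qed.

Lemma measurable_forall_ord m (A : 'I_m -> set U) :
  (forall j, measurable (A j)) -> measurable [set z | forall j, A j z].
Proof.
move=> mA; have -> : [set z | forall j, A j z] =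
    \bigcap_(j in [set` [set: 'I_m]%SET]) A j.
  apply/seteqP; split=> z /= zA j; first by move=> _; exact: zA.
  by apply: zA => /=; rewrite inE.
by apply: fin_bigcap_measurable.
Qed.

End MeasurableVectors.

Section SLassoRandom.
Variables (R : realType) (n p : nat) (X : 'M[R]_(n, p)) (lam mu : R).
Hypothesis n_gt0 : (0 < n)%N.
Hypothesis lam_gt0 : 0 < lam.
Hypothesis mu_ge0 : 0 <= mu.
Variable bhat : 'cV[R]_n -> 'cV[R]_p.
Hypothesis bhatP : forall y, is_slasso lam mu X y (bhat y).

Let c := halfpen n lam.

Section Measurable.
Context d (U : measurableType d) (y : U -> 'cV[R]_n).
Hypothesis my : measurable_cV y.

Lemma measurable_candidate s :
  measurable_cV (fun z => candidate X lam mu s (y z)).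
Proof.
apply: measurable_mulmx; apply: measurable_cVB.
  exact: measurable_mulmx.
exact: measurable_cV_cst.
Qed.

(** A sign pattern is realized exactly when the candidate solution it
    determines has these signs and is stationary, which are finitely many
    conditions on affine functions of the response. *)
Lemma measurable_pattern s : measurable ((fun z => pattern (bhat (y z))) @^-1` [set s]).
Proof.
pose b z := candidate X lam mu s (y z).
pose g z := X^T *m y z - gram X mu *m b z.
have mb : measurable_cV b := measurable_candidate s.
have mg : measurable_cV g.
  by apply: measurable_cVB; exact: measurable_mulmx.
have -> : (fun z => pattern (bhat (y z))) @^-1` [set s] =
    [set z | forall j, ((0 < b z j 0) == (j \in s.1)) &&
      ((b z j 0 < 0) == (j \in s.2))] `&`
    [set z | forall j, (`|g z j 0| <= c) && (g z j 0 * b z j 0 == c * `|b z j 0|)].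
  apply/seteqP; split=> z /=.
    move=> /(pattern_bhatP n_gt0 lam_gt0 mu_ge0 bhatP)[/pattern_eqP sP kP].
    split=> j; first by case: (sP j) => -> ->; rewrite !eqxx.
    by case: (kP j) => -> /eqP.
  move=> [sP kP]; apply/(pattern_bhatP n_gt0 lam_gt0 mu_ge0 bhatP); split.
    by apply/pattern_eqP => j; have /andP[/eqP -> /eqP ->] := sP j.
  by move=> j; have /andP[? /eqP ?] := kP j.
have mnorm (h : U -> R) : measurable_fun setT h -> measurable_fun setT (fun z => `|h z|).
  by move=> mh; exact: measurableT_comp.
have meq_cst (h : U -> bool) e : measurable_fun setT h ->
    measurable_fun setT (fun z => h z == e).
  move=> mh; case: e; first by under eq_fun do rewrite eqb_id.
  by under eq_fun do rewrite eqbF_neg; exact: measurable_neg.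
apply: measurableI; apply: measurable_forall_ord => j; apply: measurable_bool_set;
  apply: measurable_and.
- by apply: meq_cst; exact: measurable_fun_ltr.
- by apply: meq_cst; exact: measurable_fun_ltr.
- by apply: measurable_fun_ler => //; apply: mnorm; exact: mg.
- by apply: measurable_fun_eqr; apply: measurable_funM => //; apply: mnorm; exact: mb.
Qed.

Lemma measurable_fit i : measurable_fun setT (fun z => (X *m bhat (y z)) i 0).
Proof.
have -> : (fun z => (X *m bhat (y z)) i 0) =
    (fun z => (X *m candidate X lam mu (pattern (bhat (y z))) (y z)) i 0).
  by apply/funext => z; rewrite -(is_slasso_candidate n_gt0 lam_gt0 (@bhatP _)).
apply: (measurable_fun_cases measurable_pattern
  (F := fun s z => (X *m candidate X lam mu s (y z)) i 0)) => s.
exact: (measurable_mulmx X (measurable_candidate s)).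
Qed.

Lemma measurable_pattern_fun (F : {set 'I_p} * {set 'I_p} -> R) :
  measurable_fun setT (fun z => F (pattern (bhat (y z)))).
Proof.
by apply: (measurable_fun_cases measurable_pattern (F := fun s _ => F s)) => s.
Qed.

End Measurable.

(** The slope of the [i]-th fitted value in the [i]-th response, on the region
    of pattern [s]. *)
Definition leverage (i : 'I_n) (s : {set 'I_p} * {set 'I_p}) : R :=
  (X *m sol_op (gram X mu) (s.1 :|: s.2) *m X^T) i i.

(** When only the [i]-th response moves, convexity of the pattern regions makes
    them intervals, the Lipschitz bound gives continuity and linear growth, and
    [candidate] gives the slope: these are the hypotheses of
    [stein_piecewise_affine]. *)
Lemma stein_fit_line (sigma : R) (y : 'cV[R]_n) i : 0 < sigma ->
  (\int[gaussian_law sigma]_t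
     (t * (X *m bhat (y + t *: delta_mx i 0)) i 0)%:E =
   \int[gaussian_law sigma]_t
     (sigma ^+ 2 * leverage i (pattern (bhat (y + t *: delta_mx i 0))))%:E)%E.
Proof.
move=> sigma_gt0; pose line (t : R) := y + t *: delta_mx i 0.
pose g t := (X *m bhat (line t)) i 0.
have lip t u : `|g u - g t| <= `|u - t|.
  have := fit_coord_lipschitz n_gt0 lam_gt0 mu_ge0 bhatP (line t) i (u - t).
  by rewrite /line -addrA -scalerDl subrKC.
apply: (@stein_piecewise_affine _ _ sigma_gt0 _
  (fun t => pattern (bhat (line t))) (leverage i)
  (fun s => (X *m candidate X lam mu s y) i 0) g (`|g 0|)).
- move=> t; rewrite /g [in LHS](is_slasso_candidate n_gt0 lam_gt0 (@bhatP _)).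
  set s := pattern _.
  have -> : candidate X lam mu s (line t) = candidate X lam mu s y +
      t *: (sol_op (gram X mu) (s.1 :|: s.2) *m (X^T *m delta_mx i 0)).
    rewrite /candidate /line (mulmxDr X^T) addrAC [LHS]mulmxDr.
    by rewrite -!scalemxAr.
  rewrite mulmxDr -scalemxAr [LHS]mxE [LHS]addrC; congr (_ + _).
  by rewrite mxE mulrC /leverage !mulmxA -colE mxE.
- move=> a b e ab be pae.
  have [ae|ae] := eqVneq a e.
    by have -> : b = a by apply/eqP; rewrite eq_le ab ae be.
  have ea : 0 < e - a by rewrite subr_gt0 lt_neqAle ae (le_trans ab).
  pose t := (b - a) / (e - a).
  have t0 : 0 <= t by rewrite /t divr_ge0 ?subr_ge0// (le_trans ab).
  have t1 : t <= 1 by rewrite /t ler_pdivrMr// mul1r lerD2r.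
  have := pattern_bhat_convex n_gt0 lam_gt0 mu_ge0 bhatP t0 t1 pae.
  rewrite -pae => <-; congr (pattern (bhat _)).
  rewrite /line !scalerDr !scalerA addrACA -!scalerDl subrK scale1r.
  by congr (_ + _ *: _); rewrite /t; field; rewrite gt_eqF.
- move=> t; apply/cvgrPdist_le => /= e e0; near=> u.
  apply: le_trans (lip u t) _; near: u.
  exact: (@cvgr_dist_le _ _ _ _ _ id t).
- move=> t; have := lip 0 t; rewrite subr0 => h.
  by rewrite -[g t](subrKC (g 0)) (le_trans (ler_normD _ _))// lerD2l.
Unshelve. all: by end_near. Qed.

End SLassoRandom.

Lemma sqr_integrable_Lfun2 d (T : measurableType d) (R : realType)
    (m : {measure set T -> \bar R}) (f : T -> R) : measurable_fun setT f ->
  m.-integrable setT (EFin \o (fun x => f x ^+ 2)) -> f \in Lfun m 2%:E.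
Proof.
move=> mf /integrableP[_ f2]; rewrite inE; apply/andP; split; rewrite inE//=.
rewrite /finite_norm unlock /Lnorm poweR_lty//.
under eq_integral do rewrite /= powR_mulrn// -normrX.
exact: f2.
Qed.

Lemma sqr_le_sum_Lfun2 d (T : measurableType d) (R : realType) (n : nat)
    (m : {measure set T -> \bar R}) (f : T -> R) (y : 'I_n -> T -> R) :
  measurable_fun setT f -> (forall i, y i \in Lfun m 2%:E) ->
  (forall w, f w ^+ 2 <= \sum_(i < n) y i w ^+ 2) -> f \in Lfun m 2%:E.
Proof.
move=> mf y2 fy; apply: sqr_integrable_Lfun2 => //.
have sum_int : m.-integrable setT (EFin \o (fun w => \sum_(i < n) y i w ^+ 2)).
  have -> : EFin \o (fun w => \sum_(i < n) y i w ^+ 2) =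
      (fun w => \sum_(i < n) (y i w ^+ 2)%:E)%E.
    by apply/funext => w /=; rewrite sumEFin.
  by apply: integrable_sum => // i _; exact: Lfun2_integrable_sqr.
apply: (le_integrable measurableT _ _ sum_int).
- by apply/measurable_EFinP; exact: measurable_funX.
- move=> w _ /=; rewrite lee_fin ger0_norm ?sqr_ge0//.
  by rewrite (le_trans (fy w))// ler_norm.
Qed.

Section GaussianVariable.
Context d (T : measurableType d) (R : realType) (P : probability T R).
Variables (sigma : R) (Z : {RV P >-> R}).
Hypothesis sigma_gt0 : 0 < sigma.
Hypothesis Z_gauss : centered_gaussian sigma Z.

Lemma gaussian_Lfun2 : (Z : T -> R) \in Lfun P 2%:E.
Proof.
apply: sqr_integrable_Lfun2 => //.
have m2 : measurable_fun setT (fun t : R => (t ^+ 2)%:E).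
  by apply/measurable_EFinP; exact: measurable_funX.
apply/integrableP; split.
  by apply/measurable_EFinP; apply: measurable_funX.
have /integrableP[_] := integrable_gaussian_law m2 (integrable_sqr_normal sigma_gt0).
apply: le_lt_trans; rewrite le_eqVlt; apply/orP; left; apply/eqP.
transitivity (\int[distribution P Z]_t `|(t ^+ 2)%:E|)%E.
  by rewrite ge0_integral_distribution//; exact: measurableT_comp.
by apply: eq_measure_integral => A mA _; exact: Z_gauss.
Qed.

(** Stein's identity for the constant function 1. *)
Lemma gaussian_law_mean0 : (\int[gaussian_law sigma]_t t%:E = 0)%E.
Proof.
have := @stein_piecewise_affine R sigma sigma_gt0 unit (fun=> tt) (fun=> 0)
  (fun=> 1) (fun=> 1) 1.
under [X in _ -> _ -> _ -> _ -> X = _]eq_integral do rewrite mulr1.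
move=> ->; rewrite ?mulr0 ?integral0//.
- by move=> t; rewrite mul0r add0r.
- by move=> t; exact: cvg_cst.
- by move=> t; rewrite normr1 lerDl.
Qed.

Lemma gaussian_expectation0 : ('E_P[Z] = 0)%E.
Proof.
rewrite unlock -gaussian_law_mean0.
transitivity (\int[distribution P Z]_t t%:E)%E.
  rewrite integral_distribution//.
  have := Lfun_subset12 (fin_num_measure P _ measurableT) gaussian_Lfun2.
  by move/Lfun1_integrable.
by apply: eq_measure_integral => A mA _; exact: Z_gauss.
Qed.

End GaussianVariable.

(** * Unbiasedness *)

Section Unbiasedness.
Context (R : realType) (d : measure_display) (T : measurableType d).
Variables (P : probability T R) (n p : nat) (X : 'M[R]_(n, p)).
Variables (betastar : 'cV[R]_p) (sigma : R) (eps : 'I_n -> {RV P >-> R}).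
Variables (lam mu : R) (bhat : 'cV[R]_n -> 'cV[R]_p).
Hypothesis n_gt0 : (0 < n)%N.
Hypothesis sigma_gt0 : 0 < sigma.
Hypothesis eps_gauss : forall i, centered_gaussian sigma (eps i).
Hypothesis eps_indep : mutually_independent eps.
Hypothesis lam_gt0 : 0 < lam.
Hypothesis mu_ge0 : 0 <= mu.
Hypothesis bhatP : forall y, is_slasso lam mu X y (bhat y).

Local Notation vec := (n.-tuple R).

Definition noise (w : T) : vec := [tuple eps i w | i < n].

Lemma measurable_noise : measurable_fun setT noise.
Proof.
apply/measurable_fun_tnthP => i.
have -> : (fun z : vec => tnth z i) \o noise = eps i.
  by apply/funext => w; rewrite /= tnth_mktuple.
exact: measurable_funPT.
Qed.

HB.instance Definition _ := isMeasurableFun.Build _ _ _ _ noise measurable_noise.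

Definition noise_law : probability vec R := distribution P noise.

Lemma noise_law_box (B : 'I_n -> set R) : (forall j, measurable (B j)) ->
  noise_law (box B) = (\prod_(j < n) gaussian_law sigma (B j))%E.
Proof.
move=> mB; transitivity (P (\bigcap_(j in [set` [set: 'I_n]%SET]) (eps j @^-1` B j))).
  rewrite -[LHS]/(P (noise @^-1` box B)); congr (P _).
  apply/seteqP; split=> w wB j; last rewrite tnth_mktuple.
    by move=> _; have := wB j; rewrite tnth_mktuple.
  by apply: wB => /=; rewrite inE.
rewrite eps_indep//; apply: eq_big => j; first by rewrite inE.
by move=> _; exact: eps_gauss.
Qed.

Definition resp (z : vec) : 'cV[R]_n := X *m betastar + \col_i tnth z i.

Lemma responseE w : response X betastar eps w = resp (noise w).
Proof.
apply/colP => i; rewrite !mxE tnth_mktuple; congr (_ + _).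
by apply: eq_bigr => k _; rewrite mxE.
Qed.

Lemma measurable_resp : measurable_cV resp.
Proof.
move=> j; have -> : (fun z => resp z j 0) =
    (fun z : vec => (X *m betastar) j 0 + tnth z j).
  by apply/funext => z; rewrite !mxE.
by apply: measurable_funD => //; exact: measurable_tnth.
Qed.

Lemma resp_update i z t :
  resp (update i z t) = resp (update i z 0) + t *: delta_mx i 0.
Proof.
apply/colP => j; rewrite !mxE !tnth_mktuple eqxx andbT.
by case: eqP => _; rewrite ?mulr1 ?mulr0 ?addr0.
Qed.

Let fit i z := (X *m bhat (resp z)) i 0.
Let lev i z := leverage X mu i (pattern (bhat (resp z))).

Let measurable_fit_resp i : measurable_fun setT (fit i).
Proof. exact: (measurable_fit n_gt0 lam_gt0 mu_ge0 bhatP measurable_resp). Qed.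

Let measurable_lev i : measurable_fun setT (lev i).
Proof. exact: (measurable_pattern_fun n_gt0 lam_gt0 mu_ge0 bhatP measurable_resp). Qed.

Let eps_Lfun2 i : (eps i : T -> R) \in Lfun P 2%:E.
Proof. exact: gaussian_Lfun2 sigma_gt0 (eps_gauss i). Qed.

Let Lfun21 (f : T -> R) : f \in Lfun P 2%:E -> f \in Lfun P 1.
Proof. by apply: Lfun_subset12; exact: fin_num_measure. Qed.

Let resp_Lfun2 i : (fun w => resp (noise w) i 0) \in Lfun P 2%:E.
Proof.
have -> : (fun w => resp (noise w) i 0) = cst ((X *m betastar) i 0) \+ eps i.
  by apply/funext => w; rewrite !mxE tnth_mktuple.
by apply: rpredD => [|?|?]; [rewrite lee1n|exact: Lfun_cst|exact: eps_Lfun2].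
Qed.

Let fit_Lfun2 i : (fun w => fit i (noise w)) \in Lfun P 2%:E.
Proof.
apply: (sqr_le_sum_Lfun2 _ resp_Lfun2).
  exact: measurableT_comp (measurable_fit_resp i) measurable_noise.
move=> w; have := fit_norm_le n_gt0 lam_gt0 mu_ge0 bhatP (resp (noise w)).
rewrite /dot; under [X in _ <= X -> _]eq_bigr do rewrite -expr2.
apply: le_trans; rewrite (bigD1 i)//= -expr2 lerDl sumr_ge0// => j _.
exact: sqr_ge0.
Qed.

Let integrable_lev i : noise_law.-integrable setT (EFin \o lev i).
Proof.
have [M HM] := finite_values_bounded (leverage X mu i).
by apply: (bounded_integrable _ (measurable_lev i)) => z; exact: HM.
Qed.

Let integrable_lev_noise i : P.-integrable setT (fun w => (lev i (noise w))%:E).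
Proof.
have [M HM] := finite_values_bounded (leverage X mu i).
have m := measurableT_comp (measurable_lev i) measurable_noise.
by apply: (bounded_integrable _ m) => z; exact: HM.
Qed.

(** Resampling the [i]-th coordinate of the noise reduces this to
    [stein_fit_line], applied with the other coordinates frozen. *)
Lemma stein_fit i :
  (\int[P]_w (eps i w * fit i (noise w))%:E =
   (sigma ^+ 2)%:E * \int[P]_w (lev i (noise w))%:E)%E.
Proof.
have epsE w : eps i w = tnth (noise w) i by rewrite tnth_mktuple.
have mh : measurable_fun setT (fun z : vec => tnth z i * fit i z).
  by apply: measurable_funM => //; exact: measurable_tnth.
have hP : P.-integrable setT (fun w => (eps i w * fit i (noise w))%:E).
  by have /Lfun1_integrable := Lfun2_mul_Lfun1 (eps_Lfun2 i) (fit_Lfun2 i).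
have mhE : measurable_fun setT (EFin \o (fun z : vec => tnth z i * fit i z)).
  exact/measurable_EFinP.
have hPnu : P.-integrable setT
    ((EFin \o (fun z : vec => tnth z i * fit i z)) \o noise).
  by apply: eq_integrable hP => // w _; rewrite /= epsE.
have hnu : noise_law.-integrable setT (EFin \o (fun z : vec => tnth z i * fit i z)).
  exact: (integrable_pushforward measurable_noise).
have mlev : measurable_fun setT (fun z => sigma ^+ 2 * lev i z).
  exact: measurable_funM.
have lnu : noise_law.-integrable setT (EFin \o (fun z => sigma ^+ 2 * lev i z)).
  exact: (integrableZl measurableT (sigma ^+ 2) (integrable_lev i)).
transitivity (\int[noise_law]_z (tnth z i * fit i z)%:E)%E.
  rewrite integral_distribution//.
  by apply: eq_integral => w _; rewrite /= epsE.
rewrite (integral_resample i noise_law_box hnu).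
transitivity (\int[noise_law]_z (sigma ^+ 2 * lev i z)%:E)%E.
  rewrite (integral_resample i noise_law_box lnu).
  apply: eq_integral => z _.
  have := stein_fit_line n_gt0 lam_gt0 mu_ge0 bhatP (resp (update i z 0)) i sigma_gt0.
  under eq_integral do rewrite -resp_update.
  under [X in _ = X -> _]eq_integral do rewrite -resp_update.
  by under [X in _ -> X = _]eq_integral do rewrite update_id.
rewrite -integralZl// integral_distribution//; first exact/measurable_EFinP.
exact: (integrableZl measurableT (sigma ^+ 2) (integrable_lev_noise i)).
Qed.

(** The [i]-th response is the centered noise plus a constant, so [stein_fit]
    computes the whole covariance. *)
Lemma covariance_fit i : covariance P (fun w => response X betastar eps w i 0)
    (fun w => (X *m bhat (response X betastar eps w)) i 0) =
  ((sigma ^+ 2)%:E * \int[P]_w (lev i (noise w))%:E)%E.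
Proof.
have -> : (fun w => response X betastar eps w i 0) =
    cst ((X *m betastar) i 0) \+ eps i.
  by apply/funext => w; rewrite responseE !mxE tnth_mktuple.
have -> : (fun w => (X *m bhat (response X betastar eps w)) i 0) =
    (fun w => fit i (noise w)).
  by apply/funext => w; rewrite responseE.
rewrite covarianceDl ?Lfun_cst// covariance_cst_l add0e.
rewrite covarianceE; first last.
- exact: (Lfun2_mul_Lfun1 (eps_Lfun2 i) (fit_Lfun2 i)).
- exact: Lfun21.
- exact: Lfun21.
rewrite (gaussian_expectation0 sigma_gt0 (eps_gauss i)) mul0e sube0.
by rewrite -stein_fit unlock.
Qed.

Lemma df_hat_leverage (b : 'cV[R]_p) : df_hat mu X (active_set b) =
  \sum_i leverage X mu i (pattern b).
Proof. by rewrite df_hatE active_pattern. Qed.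

Lemma unbiased_df_hat :
  unbiased_estimate P
    (fun w => df_hat mu X (active_set (bhat (response X betastar eps w))))
    (eff_df P sigma (response X betastar eps) (fun y => X *m bhat y)).
Proof.
have -> : (fun w => df_hat mu X (active_set (bhat (response X betastar eps w)))) =
    (fun w => \sum_i lev i (noise w)).
  by apply/funext => w; rewrite responseE df_hat_leverage.
have sumE : EFin \o (fun w => \sum_i lev i (noise w)) =
    (fun w => \sum_i (lev i (noise w))%:E)%E.
  by apply/funext => w /=; rewrite sumEFin.
split; first by rewrite sumE; apply: integrable_sum.
rewrite unlock /eff_df.
transitivity (\sum_i \int[P]_w (lev i (noise w))%:E)%E.
  by rewrite -integral_sum//; apply: eq_integral => w _; rewrite -sumEFin.
under [in RHS]eq_bigr do rewrite covariance_fit.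
have levfin i : (\int[P]_w (lev i (noise w))%:E)%E \is a fin_num.
  exact: integrable_fin_num.
rewrite -fin_num_sume_distrr//; last first.
  by move=> j k _ _; rewrite fin_num_adde_defl.
by rewrite muleA -EFinM mulVf ?mul1e// expf_neq0// gt_eqF.
Qed.

End Unbiasedness.

Theorem theorem7 (R : realType) (d : measure_display) (T : measurableType d)
    (P : probability T R) (n p : nat) (X : 'M[R]_(n, p))
    (betastar : 'cV[R]_p) (sigma : R) (eps : 'I_n -> {RV P >-> R})
    (lambda mu : R) (betahat : 'cV[R]_n -> 'cV[R]_p)
    (X_std : standardized X)
    (sigma_gt0 : 0 < sigma)
    (eps_gauss : forall i, centered_gaussian sigma (eps i))
    (eps_indep : mutually_independent eps)
    (lambda_gt0 : 0 < lambda)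
    (mu_ge0 : 0 <= mu)
    (betahat_slasso : forall y, is_slasso lambda mu X y (betahat y)) :
  let Y := response X betastar eps in
  unbiased_estimate P
    (fun w => df_hat mu X (active_set (betahat (Y w))))
    (eff_df P sigma Y (fun y => X *m betahat y)).
Proof.
have [n0|n_gt0] := posnP n; last first.
  exact: (unbiased_df_hat _ n_gt0 sigma_gt0 eps_gauss eps_indep lambda_gt0 mu_ge0).
(* With no observation, both sides are empty sums. *)
subst n => Y; rewrite /eff_df big_ord0 mule0.
have -> : (fun w => df_hat mu X (active_set (betahat (Y w)))) = cst 0.
  by apply/funext => w; rewrite /df_hat /mxtrace big_ord0.
by split; [exact: finite_measure_integrable_cst|exact: expectation_cst].
Qed.
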